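(* Let $C_z\geq 1$ and let $z$ be a $C_z$-good complex random variable. There exists a constant $C \geq 1$ depending only on $C_z$ such that the following holds for every positive integer $n$. For every $\boldsymbol{a}\in \mathbb{S}^{2n-1}$, every $\alpha \in (0,\sqrt{n})$, every $\gamma \in (0,1)$, and every $$\delta \geq \frac{n^{0.1}\alpha}{\mathrm{LCD}_{\gamma,\alpha}(\boldsymbol{a})},$$ we have $$\rho_{\delta, z}(\boldsymbol{a}) \leq C\left(\frac{\sqrt{n}\,\delta}{\gamma} + \exp\left(-C^{-1}\alpha^{2}\right)\right).$$
   Context: $\mathbb{S}^{2n-1}$ denotes the set of unit vectors (in the Euclidean norm) in $\mathbb{C}^n$. A complex random variable $z$ is called $C$-good if $\Pr(C^{-1}\leq |z_1-z_2|\leq C)\geq C^{-1}$, where $z_1,z_2$ are independent copies of $z$. Lévy concentration function: for a complex random variable $z$, $\boldsymbol{v}=(v_1,\dots,v_n)\in\mathbb{C}^n$ and $r>0$, $$\rho_{r,z}(\boldsymbol{v}):=\sup_{x\in\mathbb{C}}\Pr\left(v_1z_1+\dots+v_nz_n\in B(x,r)\right),$$ where $z_1,\dots,z_n$ are independent copies of $z$ and $B(x,r)$ is the ball of radius $r$ centered at $x$ in $\mathbb{C}$. Least Common Denominator: for $\boldsymbol{a}\in\mathbb{C}^n\setminus\{\boldsymbol 0\}$, $\gamma\in(0,1)$ and $\alpha>0$, $$\mathrm{LCD}_{\gamma,\alpha}(\boldsymbol{a}):=\inf_{\theta\in\mathbb{C}}\left\{|\theta|>0 : \mathrm{dist}(\theta\boldsymbol{a},(\mathbb{Z}+i\mathbb{Z})^n)<\min\{\gamma|\theta|\,\|\boldsymbol{a}\|_2,\alpha\}\right\},$$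 where $\mathrm{dist}$ is Euclidean distance. *)

(* Defs.v *)
From HB Require Import structures.
From mathcomp Require Import all_boot all_order all_algebra.
From mathcomp Require Import all_classical all_reals all_analysis.
From mathcomp Require Import complex.
Import Order.TTheory GRing.Theory Num.Theory.
Import numFieldNormedType.Exports.
Export Normc.

Set Implicit Arguments.
Unset Strict Implicit.
Unset Printing Implicit Defensive.

Local Open Scope classical_set_scope.
Local Open Scope ring_scope.

Section complex_measurable.
Context {R : realType}.

Definition complex_coords (z : R[i]) : R * R := (complex.Re z, complex.Im z).

(* The Borel sigma-algebra of the complex plane identified with R^2. *)
Definition complex_measurable : set (set R[i]) :=
  preimage_set_system setT complex_coords (@measurable _ (R * R)%type).

Let complex_sigma_algebra : sigma_algebra setT complex_measurable.
Proof. exact/sigma_algebra_preimage/sigma_algebra_measurable. Qed.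

Let complex_measurable0 : complex_measurable set0.
Proof. by case: complex_sigma_algebra. Qed.

Let complex_measurableC A :
  complex_measurable A -> complex_measurable (~` A).
Proof. by case: complex_sigma_algebra => _ h _ /h; rewrite setTD. Qed.

Let complex_measurable_bigcup (F : (set R[i])^nat) :
  (forall i, complex_measurable (F i)) ->
  complex_measurable (\bigcup_i (F i)).
Proof. by case: complex_sigma_algebra => _ _; apply. Qed.

HB.instance Definition _ := isPointed.Build R[i] 0.

HB.instance Definition _ := @isMeasurable.Build default_measure_display R[i]
  complex_measurable complex_measurable0 complex_measurableC
  complex_measurable_bigcup.

End complex_measurable.

(* z o fst and z o snd on the product space T x T with measure P x P are two
   independent copies of z. *)
Definition C_good {R : realType} {d} {T : measurableType d}
    (P : probability T R) (C : R) (z : {RV P >-> R[i]}) : Prop :=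
  ((C^-1)%:E <=
   (P \x P) [set w | (C^-1 <= normc (z w.1 - z w.2) <= C)%R])%E.

Definition mutually_independent {R : realType} {d} {T : measurableType d}
    (P : probability T R) {n : nat} (Z : 'I_n -> {RV P >-> R[i]}) : Prop :=
  forall A : 'I_n -> set R[i], (forall i, measurable (A i)) ->
  (P (\bigcap_i (Z i @^-1` A i)) = \prod_(i < n) P (Z i @^-1` A i))%E.

Definition independent_copies {R : realType}
    {d} {T : measurableType d} (P : probability T R) (z : {RV P >-> R[i]})
    {d'} {T' : measurableType d'} (Q : probability T' R)
    {n : nat} (Z : 'I_n -> {RV Q >-> R[i]}) : Prop :=
  (forall i (A : set R[i]), measurable A ->
     distribution Q (Z i) A = distribution P z A) /\
  mutually_independent Z.

(* The concentration function rho_{r,z}(v), computed from a family Z of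
   independent copies of z; its value depends only on the law of z. The balls
   are closed. *)
Definition concentration {R : realType} {d} {T : measurableType d}
    (P : probability T R) {n : nat} (Z : 'I_n -> {RV P >-> R[i]})
    (r : R) (v : 'rV[R[i]]_n) : \bar R :=
  ereal_sup [set P [set w | normc (\sum_(i < n) v 0 i * Z i w - x) <= r]
            | x in [set: R[i]]].

Definition l2norm {R : realType} {n : nat} (v : 'rV[R[i]]_n) : R :=
  Num.sqrt (\sum_(i < n) normc (v 0 i) ^+ 2).

Definition gaussian_lattice {R : realType} {n : nat} : set 'rV[R[i]]_n :=
  [set g | forall i, complex.Re (g 0 i) \is a Num.int /\
                     complex.Im (g 0 i) \is a Num.int].

Definition dist_gaussian {R : realType} {n : nat} (v : 'rV[R[i]]_n) : R :=
  inf [set l2norm (v - g) | g in gaussian_lattice].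

Definition LCD {R : realType} {n : nat} (gamma alpha : R) (a : 'rV[R[i]]_n)
    : \bar R :=
  ereal_inf [set (normc theta)%:E | theta in
    [set theta : R[i] | 0 < normc theta /\
       dist_gaussian (theta *: a) <
         Num.min (gamma * normc theta * l2norm a) alpha]].

(* Main.v *)
Require Import Defs.
From HB Require Import structures.
From mathcomp Require Import all_boot all_order all_algebra.
From mathcomp Require Import all_classical all_reals all_analysis.
From mathcomp Require Import complex measurable_realfun.
From mathcomp Require Import ring lra.
Import Order.TTheory GRing.Theory Num.Theory.
Import numFieldNormedType.Exports.

Local Open Scope classical_set_scope.
Local Open Scope ring_scope.

(** Write [S] for the sum of the [a_i z_i] and [phi] for its characteristic
    function.

    A discrete form of Esseen's inequality ([esseen_grid]) bounds the probability
    that [S] lies in a disc of radius [delta] by an average of [|phi|] over the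
    differences of a fine square grid of frequencies of diameter about
    [1 / delta]. Averaging over a grid replaces Fourier integrals by finite
    sums.

    By independence ([mean_prod_indep], [mean_cos_sum_le]) and symmetrization
    ([charmod_sqr]), [|phi (theta)| <= exp (- Phi (theta))], where
    [Phi = mean_defect] averages, over the difference [s] of two copies of [z],
    half the sum of the [1 - cos (2 pi Re (theta s a_j))]
    ([mean_cos_le_expR]). The summand is comparable to the squared distance from
    [Re (theta s a_j)] to the integers. Only real parts appear, whereas the least
    common denominator involves the distance to the Gaussian integers, so a
    bound on [Phi (theta)] alone says nothing about it.

    The remedy is a doubling argument ([box_sum_sqr_le]). Since
    [1 - cos] is a squared chord, [Phi (x + y) <= 2 Phi x + 2 Phi y]. In the square
    of the sum [J] of the [exp (- Phi (t))], group the pairs [(t, t')] by the value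
    of [t + i t']. Two pairs in one class differ by [(- i x, x)] for some [x], so
    comparing with the heaviest pair of the class bounds each weight by
    [exp (- (Phi x + Phi (i x)) / 4)]. Real and imaginary parts now both appear:
    [Phi x + Phi (i x)] is at least a constant times the mean of the squared
    distance of [x s a] to the Gaussian integers ([defect_ge_dist]).

    As [z] is good, [|s|] is comparable to 1 with probability bounded below. All
    the [x] involved have modulus [O (1 / delta)], so [x s] is below the least
    common denominator by the lower bound on [delta], unless [alpha] is smaller
    than a constant, when the claim is trivial. That distance is therefore at
    least [min (c gamma |x|, alpha)] ([mean_defect_ge_min]). Summing a Gaussian
    over the grid ([gauss_sum_le]) bounds the normalized [J ^ 2] by a multiple of
    [(delta / gamma) ^ 2 + exp (- c alpha ^ 2)], and the square root of this is
    the bound sought. *)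

(** * Expectations of bounded measurable functions *)

Section BoundedMeasurable.
Context {R : realType} {d : measure_display} {T : measurableType d}.
Implicit Types (f g : T -> R).

Definition bounded_measurable f :=
  measurable_fun setT f /\ exists M : R, forall x, `|f x| <= M.

Lemma bm_cst c : bounded_measurable (fun=> c).
Proof. by split; [exact: measurable_cst|exists `|c|]. Qed.

Lemma bmD f g : bounded_measurable f -> bounded_measurable g ->
  bounded_measurable (fun x => f x + g x).
Proof.
move=> [mf [M fM]] [mg [N gN]]; split; first exact: measurable_funD.
by exists (M + N) => x; rewrite (le_trans (ler_normD _ _))// lerD.
Qed.

Lemma bmM f g : bounded_measurable f -> bounded_measurable g ->
  bounded_measurable (fun x => f x * g x).
Proof.
move=> [mf [M fM]] [mg [N gN]]; split; first exact: measurable_funM.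
by exists (M * N) => x; rewrite normrM ler_pM.
Qed.

Lemma bmZ c f : bounded_measurable f -> bounded_measurable (fun x => c * f x).
Proof. by apply: bmM; exact: bm_cst. Qed.

Lemma bmB f g : bounded_measurable f -> bounded_measurable g ->
  bounded_measurable (fun x => f x - g x).
Proof.
move=> bf bg; under [X in bounded_measurable X]eq_fun do rewrite -mulN1r.
by apply: bmD => //; exact: bmZ.
Qed.

Lemma bm_sum (I : Type) (r : seq I) (p : pred I) (F : I -> T -> R) :
  (forall i, bounded_measurable (F i)) ->
  bounded_measurable (fun x => \sum_(i <- r | p i) F i x).
Proof.
move=> bF; elim: r => [|i r IH].
  by under [X in bounded_measurable X]eq_fun do rewrite big_nil; exact: bm_cst.
under [X in bounded_measurable X]eq_fun do rewrite big_cons.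
by case: (p i) => //; exact: bmD.
Qed.

Lemma bm_prod (I : Type) (r : seq I) (p : pred I) (F : I -> T -> R) :
  (forall i, bounded_measurable (F i)) ->
  bounded_measurable (fun x => \prod_(i <- r | p i) F i x).
Proof.
move=> bF; elim: r => [|i r IH].
  by under [X in bounded_measurable X]eq_fun do rewrite big_nil; exact: bm_cst.
under [X in bounded_measurable X]eq_fun do rewrite big_cons.
by case: (p i) => //; exact: bmM.
Qed.

Lemma bm_cos f : measurable_fun setT f -> bounded_measurable (fun x => cos (f x)).
Proof.
move=> mf; split; last by exists 1 => x; exact: cos_max.
apply: (measurableT_comp _ mf); apply: continuous_measurable_fun.
exact: continuous_cos.
Qed.

Lemma bm_sin f : measurable_fun setT f -> bounded_measurable (fun x => sin (f x)).
Proof.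
move=> mf; split; last by exists 1 => x; exact: sin_max.
apply: (measurableT_comp _ mf); apply: continuous_measurable_fun.
exact: continuous_sin.
Qed.

Lemma bm_indic (A : set T) : measurable A ->
  bounded_measurable (fun x => \1_A x : R).
Proof.
move=> mA; split; first exact: measurable_indic.
by exists 1 => x; rewrite indicE; case: (_ \in _); rewrite ?normr0 ?normr1.
Qed.

End BoundedMeasurable.

Lemma bm_comp {R : realType} {d d' : measure_display} {T : measurableType d}
    {V : measurableType d'} (X : T -> V) (g : V -> R) :
  measurable_fun setT X -> bounded_measurable g ->
  bounded_measurable (fun x => g (X x)).
Proof.
move=> mX [mg [M gM]]; split; first exact: (measurableT_comp mg mX).
by exists M => x.
Qed.

(** Layer-cake rounding: applied to [y = g v], each summand is the indicator of
    a superlevel set of [g]. *)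
Lemma step_approx {R : realType} {e y : R} {N : nat} :
  0 < e -> 0 <= y <= N%:R * e ->
  `|y - e * \sum_(m < N) (m.+1%:R * e <= y)%R%:R| <= e.
Proof.
move=> e0 /andP[y0 yN].
suff H k : e * \sum_(m < k) (m.+1%:R * e <= y)%R%:R <= y /\
    (y < k.+1%:R * e -> y <= e * \sum_(m < k) (m.+1%:R * e <= y)%R%:R + e) /\
    (k%:R * e <= y -> e * \sum_(m < k) (m.+1%:R * e <= y)%R%:R = k%:R * e).
  have [h1 [h2 _]] := H N.
  rewrite ger0_norm ?subr_ge0// lerBlDl; apply: h2.
  by rewrite (le_lt_trans yN)// ltr_pM2r// ltr_nat.
elim: k => [|k [IH1 [IH2 IH3]]].
  by rewrite big_ord0 mulr0 add0r mul1r mul0r; split => //; split => // /ltW.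
rewrite big_ord_recr /=; case: (leP (k.+1%:R * e) y) => ky /=.
  have kle : k%:R * e <= y by rewrite (le_trans _ ky)// ler_pM2r// ler_nat.
  have E : e * (\sum_(i < k) (i.+1%:R * e <= y)%R%:R + 1) = k.+1%:R * e.
    by rewrite mulrDr IH3// -natr1 mulrDl mul1r mulr1.
  rewrite E; split => //; split => // h.
  by rewrite -[X in _ + X]mul1r -mulrDl natr1 ltW.
by rewrite addr0; split => //; split => // _; exact: IH2.
Qed.

Section Mean.
Context {R : realType} {d : measure_display} {T : measurableType d}.
Variable P : {measure set T -> \bar R}.
Hypothesis P1 : P setT = 1%E.
Implicit Types (f g : T -> R).

Lemma bm_integrable f : bounded_measurable f -> P.-integrable setT (EFin \o f).
Proof.
move=> [mf [M fM]]; apply: measurable_bounded_integrable => //.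
  by rewrite P1 ltry.
exists M; split; first exact: num_real.
by move=> N MN x _ /=; rewrite (le_trans (fM x))// ltW.
Qed.

Lemma mean_cst c : \int[P]_x c = c :> R.
Proof. by rewrite Rintegral_cst// P1 mulr1. Qed.

Lemma meanD f g : bounded_measurable f -> bounded_measurable g ->
  \int[P]_x (f x + g x) = \int[P]_x f x + \int[P]_x g x.
Proof. by move=> bf bg; rewrite RintegralD//; exact: bm_integrable. Qed.

Lemma meanB f g : bounded_measurable f -> bounded_measurable g ->
  \int[P]_x (f x - g x) = \int[P]_x f x - \int[P]_x g x.
Proof. by move=> bf bg; rewrite RintegralB//; exact: bm_integrable. Qed.

Lemma meanZ c f : bounded_measurable f ->
  \int[P]_x (c * f x) = c * \int[P]_x f x.
Proof. by move=> bf; rewrite RintegralZl//; exact: bm_integrable. Qed.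

Lemma mean_sum (I : Type) (r : seq I) (p : pred I) (F : I -> T -> R) :
  (forall i, bounded_measurable (F i)) ->
  \int[P]_x (\sum_(i <- r | p i) F i x) = \sum_(i <- r | p i) \int[P]_x F i x.
Proof.
move=> bF; elim: r => [|i r IH].
  by rewrite big_nil -[RHS]mean_cst; apply: eq_Rintegral => x _; rewrite big_nil.
rewrite big_cons -IH; case: ifPn => pi.
  rewrite -meanD//; last exact: bm_sum.
  by apply: eq_Rintegral => x _; rewrite big_cons pi.
by apply: eq_Rintegral => x _; rewrite big_cons (negPf pi).
Qed.

Lemma le_mean f g : bounded_measurable f -> bounded_measurable g ->
  (forall x, f x <= g x) -> \int[P]_x f x <= \int[P]_x g x.
Proof. by move=> bf bg fg; apply: le_Rintegral => //; exact: bm_integrable. Qed.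

Lemma norm_mean_le f c : bounded_measurable f -> (forall x, `|f x| <= c) ->
  `|\int[P]_x f x| <= c.
Proof.
move=> bf fc; rewrite ler_norml; apply/andP; split.
  rewrite -[leLHS]mean_cst; apply: le_mean => //; first exact: bm_cst.
  by move=> x; have := fc x; rewrite ler_norml => /andP[].
rewrite -[leRHS]mean_cst; apply: le_mean => //; first exact: bm_cst.
by move=> x; rewrite (le_trans (ler_norm _)).
Qed.

Lemma mean_indic (A : set T) : measurable A ->
  (\int[P]_x (\1_A x : R))%:E = P A.
Proof.
move=> mA; rewrite /Rintegral integral_indic// setIT fineK//.
rewrite ge0_fin_numE// (@le_lt_trans _ _ (P setT))//; last by rewrite P1 ltry.
by apply: le_measure; rewrite ?inE.
Qed.

(** A bounded function is within [e] of a finite combination of indicators of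
    its superlevel sets, so an identity that is linear and continuous in the
    function needs to be checked on indicators only. *)
Lemma mean_mul_comp {d' : measure_display} {V : measurableType d'}
    (X : T -> V) (G : T -> R) (c : R) (g : V -> R) :
  measurable_fun setT X -> bounded_measurable G -> bounded_measurable g ->
  (forall A : set V, measurable A ->
     \int[P]_x (\1_A (X x) * G x) = (\int[P]_x \1_A (X x)) * c) ->
  \int[P]_x (g (X x) * G x) = (\int[P]_x g (X x)) * c.
Proof.
move=> mX bG bg HA.
have bgX : bounded_measurable (fun x => g (X x)) by exact: bm_comp.
have [_ [B GB]] := bG; have [mg [M gM]] := bg.
apply/eqP; rewrite -subr_eq0 -normr_le0; apply/ler_addgt0Pr => e e0.
rewrite add0r; pose K := `|B| + `|c| + 1.
have K0 : 0 < K by rewrite /K ltr_wpDl// addr_ge0.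
pose e' := e / K; have e'0 : 0 < e' by rewrite divr_gt0.
pose N := (Num.truncn (2 * M / e')).+1.
have NP v : 0 <= g v + M <= N%:R * e'.
  have := gM v; rewrite ler_norml => /andP[h1 h2]; apply/andP; split; first lra.
  suff : 2 * M <= N%:R * e' by lra.
  by rewrite -ler_pdivrMr//; exact/ltW/truncnS_gt.
pose A m := [set v | m.+1%:R * e' <= g v + M].
have mA m : measurable (A m).
  rewrite -[A m]setTI -[A m]/((fun v => g v + M) @^-1` [set y | _ <= y]).
  rewrite -set_itvcy.
  suff mgM : measurable_fun setT (fun v => g v + M) by exact: mgM.
  by apply: measurable_funD => //; exact: measurable_cst.
(* [g] is shifted by its bound [M] to become nonnegative *)
pose h v : R := e' * \sum_(m < N) \1_(A m) v - M.
have hE v : `|g v - h v| <= e'.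
  have -> : g v - h v =
      (g v + M) - e' * \sum_(m < N) (m.+1%:R * e' <= g v + M)%R%:R.
    rewrite /h opprB addrCA addrA; congr (_ - _ * _); first by rewrite addrC.
    by apply: eq_bigr => m _; rewrite indicE; congr ((nat_of_bool _)%:R);
      apply/idP/idP => [/set_mem//|/mem_set].
  exact: step_approx e'0 (NP v).
have bA m : bounded_measurable (\1_(A m) : V -> R) by exact: bm_indic.
have bh : bounded_measurable h.
  by apply: bmB; [apply: bmZ; exact: bm_sum|exact: bm_cst].
have bhX : bounded_measurable (fun x => h (X x)) by exact: bm_comp.
have bAX m : bounded_measurable (fun x => \1_(A m) (X x) : R) by exact: bm_comp.
have EG : \int[P]_x G x = c.
  have := HA setT measurableT.
  under eq_Rintegral do rewrite indicT mul1r.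
  by under [in RHS]eq_Rintegral do rewrite indicT; rewrite mean_cst mul1r.
have Eh : \int[P]_x (h (X x) * G x) = (\int[P]_x h (X x)) * c.
  have -> : \int[P]_x h (X x) = e' * (\sum_(m < N) \int[P]_x \1_(A m) (X x)) - M.
    rewrite meanB ?mean_cst ?meanZ ?mean_sum//; first exact: bm_sum.
      by apply: bmZ; exact: bm_sum.
    exact: bm_cst.
  transitivity (\int[P]_x (e' * (\sum_(m < N) (\1_(A m) (X x) * G x)) - M * G x)).
    by apply: eq_Rintegral => x _; rewrite mulrBl -mulrA mulr_suml.
  rewrite meanB; [|by apply: bmZ; apply: bm_sum => m; exact: bmM|exact: bmZ].
  rewrite !meanZ ?EG//; last by apply: bm_sum => m; exact: bmM.
  rewrite mean_sum; last by move=> m; exact: bmM.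
  rewrite mulrBl -[_ * c in RHS]mulrA mulr_suml; congr (_ * _ - _).
  by apply: eq_bigr => m _; exact: HA.
have -> : \int[P]_x (g (X x) * G x) - (\int[P]_x g (X x)) * c =
    \int[P]_x ((g (X x) - h (X x)) * G x) -
    (\int[P]_x (g (X x) - h (X x))) * c.
  under [in RHS]eq_Rintegral do rewrite mulrBl.
  have E1 : \int[P]_x (g (X x) - h (X x)) =
      \int[P]_x g (X x) - \int[P]_x h (X x) by exact: meanB.
  have E2 : \int[P]_x (g (X x) * G x - h (X x) * G x) =
      \int[P]_x (g (X x) * G x) - \int[P]_x (h (X x) * G x).
    by apply: meanB; exact: bmM.
  by rewrite E1 E2 Eh; ring.
rewrite (le_trans (ler_normB _ _))//.
apply: (@le_trans _ _ (e' * `|B| + e' * `|c|)); last first.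
  rewrite -mulrDr /e' -mulrA ger_pMr// mulrC ler_pdivrMr// mul1r.
  by rewrite /K lerDl.
apply: lerD.
  apply: norm_mean_le; first by apply: bmM => //; exact: bmB.
  by move=> x; rewrite normrM ler_pM// (le_trans (GB x)) ?ler_norm.
rewrite normrM ler_pM//; apply: norm_mean_le; first exact: bmB.
by move=> x.
Qed.

End Mean.

(** * Characteristic functions of sums of independent variables *)

Section Independence.
Context {R : realType} {d : measure_display} {T : measurableType d}.
Variable Q : probability T R.

Let Q1 : Q setT = 1%E. Proof. exact: probability_setT. Qed.

(** The product rule for sets is extended to functions one coordinate at a
    time: with all other factors frozen, both sides are linear in the remaining
    one and agree when it is an indicator. *)
Lemma mean_prod_indep {n : nat} (Z : 'I_n -> {RV Q >-> R[i]})
    (g : 'I_n -> R[i] -> R) :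
  mutually_independent Z -> (forall i, bounded_measurable (g i)) ->
  \int[Q]_w (\prod_i g i (Z i w)) = \prod_i \int[Q]_w g i (Z i w).
Proof.
move=> indZ bg.
have mZ i : measurable_fun setT (Z i) by exact: measurable_funPT.
(* the coordinates from [k] on still carry indicators *)
suff H k : (k <= n)%N -> forall g : 'I_n -> R[i] -> R,
    (forall i, bounded_measurable (g i)) ->
    (forall i : 'I_n, (k <= i)%N ->
       exists A : set R[i], measurable A /\ g i = \1_A) ->
    \int[Q]_w (\prod_i g i (Z i w)) = \prod_i \int[Q]_w g i (Z i w).
  by apply: (H n (leqnn n)) => // i; rewrite leqNgt ltn_ord.
elim: k => [_|k IH kn] {bg}g bg gA.
  have /choice[A /all_and2[mA gE]] : forall i, exists A : set R[i],
    measurable A /\ g i = \1_A by move=> i; exact: gA.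
  have mZA i : measurable (Z i @^-1` A i) by rewrite -[_ @^-1` _]setTI; exact: mZ.
  have mI : measurable (\bigcap_i (Z i @^-1` A i)).
    by apply: fin_bigcap_measurable => //; exact: finite_finset.
  apply: EFin_inj; rewrite -prodEFin.
  transitivity (Q (\bigcap_i (Z i @^-1` A i))).
    rewrite -(mean_indic Q Q1)//; congr EFin; apply: eq_Rintegral => w _.
    under eq_bigr do rewrite gE.
    rewrite indicE; have [/set_mem wA|wA] := boolP (w \in _).
      by rewrite big1// => i _; rewrite indicE mem_set//; exact: wA.
    have [i iA] : exists i, ~ A i (Z i w).
      apply: contrapT => /forallNP h; move/negP: wA; apply; rewrite inE => i _.
      by have := h i; rewrite /= => /contrapT.
    by rewrite (bigD1 i)//= indicE memNset// mul0r.
  rewrite indZ//; apply: eq_bigr => i _.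
  rewrite -(mean_indic Q Q1)//; congr EFin; apply: eq_Rintegral => w _.
  by rewrite gE.
pose K := Ordinal kn.
under eq_Rintegral do rewrite (bigD1 K)//=.
rewrite (bigD1 K)//=; apply: mean_mul_comp => //.
  by apply: bm_prod => i; exact: bm_comp.
move=> A mA.
pose g' i := if i == K then \1_A : R[i] -> R else g i.
have := IH (ltnW kn) g'.
under eq_Rintegral do rewrite (bigD1 K)//=.
rewrite (bigD1 K)//= /g' eqxx.
under [in X in X -> _]eq_Rintegral => w _.
  under eq_bigr => i /negPf iK do rewrite iK.
  over.
under [in X in X -> _]eq_bigr => i /negPf iK do rewrite iK.
apply.
- by move=> i; case: eqP => _; [exact: bm_indic|exact: bg].
- move=> i ki; case: eqP => [_|iK]; first by exists A.
  apply: gA; rewrite ltn_neqAle ki andbT; apply/eqP => kE.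
  by apply: iK; apply: val_inj.
Qed.

Lemma polar (p q : R) : exists psi : R,
  p = Num.sqrt (p ^+ 2 + q ^+ 2) * cos psi /\
  q = Num.sqrt (p ^+ 2 + q ^+ 2) * sin psi.
Proof.
set r := Num.sqrt _.
have r2 : r ^+ 2 = p ^+ 2 + q ^+ 2 by rewrite sqr_sqrtr// addr_ge0// sqr_ge0.
have r0 : 0 <= r by exact: sqrtr_ge0.
have [re0|rn0] := eqVneq r 0.
  exists 0; move/eqP: r2; rewrite re0 expr0n/= eq_sym paddr_eq0 ?sqr_ge0//.
  by rewrite !sqrf_eq0 => /andP[/eqP-> /eqP->]; rewrite !mul0r.
have rp : 0 < r by rewrite lt_def rn0.
have pr : (p / r) ^+ 2 + (q / r) ^+ 2 = 1.
  by rewrite !expr_div_n -mulrDl -r2 divff// expf_neq0.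
have h1 : -1 <= p / r <= 1.
  rewrite -ler_norml -(@ler_pXn2r _ 2)// ?nnegrE// real_normK ?num_real//.
  by rewrite expr1n -pr lerDl sqr_ge0.
have ca : cos (acos (p / r)) = p / r by rewrite acosK// in_itv.
have sa : sin (acos (p / r)) = `|q / r|.
  by rewrite sin_acos// -pr addrC addKr sqrtr_sqr.
have rK y : r * (y / r) = y by rewrite mulrC divfK.
have [q0|q0] := leP 0 (q / r).
  by exists (acos (p / r)); rewrite ca sa ger0_norm// !rK.
exists (- acos (p / r)); rewrite cosN sinN ca sa ltr0_norm// opprK.
by rewrite !rK.
Qed.

(** The modulus of the characteristic function of a real variable, at 1. *)
Definition charmod (X : T -> R) : R :=
  Num.sqrt ((\int[Q]_w cos (X w)) ^+ 2 + (\int[Q]_w sin (X w)) ^+ 2).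

(** The characteristic function of a sum is the product of those of its terms:
    in polar form, moduli multiply and arguments add. *)
Lemma mean_cos_sum_le {n : nat} (Z : 'I_n -> {RV Q >-> R[i]})
    (u : 'I_n -> R[i] -> R) (x : R) :
  mutually_independent Z -> (forall i, measurable_fun setT (u i)) ->
  \int[Q]_w cos (x + \sum_i u i (Z i w)) <= \prod_i charmod (u i \o Z i).
Proof.
move=> indZ mu.
have mZ i : measurable_fun setT (Z i) by exact: measurable_funPT.
(* The factors [g i] with [k <= i] receive the cosine and the sine of the next
   term when the addition formula splits it off. *)
suff H k : (k <= n)%N -> exists psi, forall x (g : 'I_n -> R[i] -> R),
    (forall i, bounded_measurable (g i)) ->
    \int[Q]_w (cos (x + \sum_(i < n | (i < k)%N) u i (Z i w)) *
               \prod_(i < n | (k <= i)%N) g i (Z i w)) =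
    (\prod_(i < n | (i < k)%N) charmod (u i \o Z i)) * cos (x + psi) *
    \prod_(i < n | (k <= i)%N) \int[Q]_w g i (Z i w).
  have [psi /(_ x (fun=> fun=> 1) (fun=> bm_cst 1)) E] := H n (leqnn n).
  have Pn (F : 'I_n -> R) : \prod_(i < n | (n <= i)%N) F i = 1.
    by rewrite big_pred0// => i; rewrite leqNgt ltn_ord.
  have Sn (F : 'I_n -> R) : \sum_(i < n | (i < n)%N) F i = \sum_i F i.
    by apply: eq_bigl => i; rewrite ltn_ord.
  have Tn (F : 'I_n -> R) : \prod_(i < n | (i < n)%N) F i = \prod_i F i.
    by apply: eq_bigl => i; rewrite ltn_ord.
  move: E; rewrite !Pn Tn mulr1; under eq_Rintegral do rewrite Sn mulr1.
  move=> ->; rewrite ler_piMr ?cos_le1//.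
  by apply: prodr_ge0 => i _; exact: sqrtr_ge0.
elim: k => [_|k IH kn].
  exists 0 => {}x g bg.
  rewrite [in RHS]big_pred0// mul1r addr0 -mean_prod_indep// -meanZ//.
    by apply: eq_Rintegral => w _; rewrite [X in _ + X]big_pred0// addr0.
  by apply: bm_prod => i; exact: bm_comp.
pose K := Ordinal kn; have [psi {}IH] := IH (ltnW kn).
have ltK (i : 'I_n) : (i < k.+1)%N && (i != K) = (i < k)%N.
  by rewrite ltnS [RHS]ltn_neqAle andbC.
have geK (i : 'I_n) : (k <= i)%N && (i != K) = (k < i)%N.
  by rewrite [RHS]ltn_neqAle andbC eq_sym.
have [psiK [pE qE]] : exists psi,
    \int[Q]_w (cos \o u K) (Z K w) = charmod (u K \o Z K) * cos psi /\
    \int[Q]_w (sin \o u K) (Z K w) = charmod (u K \o Z K) * sin psi.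
  exact: polar.
exists (psi + psiK) => {}x g bg.
pose gw (f : R -> R) i := if i == K then f \o u K else g i.
have bgw (f : R -> R) : bounded_measurable (f \o u K) ->
    forall i, bounded_measurable (gw f i).
  by move=> bf i; rewrite /gw; case: eqP.
have gwP f (F : 'I_n -> (R[i] -> R) -> R) :
    \prod_(i < n | (k <= i)%N) F i (gw f i) =
    F K (f \o u K) * \prod_(i < n | (k < i)%N) F i (g i).
  rewrite (bigD1 K)//= /gw eqxx; congr (_ * _).
  by apply: eq_big => // i /andP[_ /negPf ->].
have bc : bounded_measurable (cos \o u K) by exact: bm_cos.
have bs : bounded_measurable (sin \o u K) by exact: bm_sin.
have mS k' : measurable_fun setT (fun w => \sum_(i < n | (i < k')%N) u i (Z i w)).
  under eq_fun do rewrite -big_filter.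
  apply: (@measurable_sum _ _ _ _ _ _ (fun i w => u i (Z i w))) => i.
  exact: measurableT_comp.
have bm1 y f : bounded_measurable (f \o u K) -> bounded_measurable (fun w =>
    cos (y + \sum_(i < n | (i < k)%N) u i (Z i w)) *
    \prod_(i < n | (k <= i)%N) gw f i (Z i w)).
  move=> bf; apply: bmM; last by apply: bm_prod => i; apply: bm_comp => //; exact: bgw.
  by apply: bm_cos; apply: measurable_funD => //; exact: measurable_cst.
have := IH x (gw cos) (bgw _ bc); rewrite (gwP _ (fun i f => \int[Q]_w f (Z i w))).
have := IH (x - pi / 2) (gw sin) (bgw _ bs).
rewrite (gwP _ (fun i f => \int[Q]_w f (Z i w))) => Es Ec.
transitivity (\int[Q]_w (cos (x + \sum_(i < n | (i < k)%N) u i (Z i w)) *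
                          \prod_(i < n | (k <= i)%N) gw cos i (Z i w) -
    (cos (x - pi / 2 + \sum_(i < n | (i < k)%N) u i (Z i w)) *
                          \prod_(i < n | (k <= i)%N) gw sin i (Z i w)))).
  apply: eq_Rintegral => w _; rewrite !(gwP _ (fun i f => f (Z i w))).
  rewrite (bigD1 K)//= (eq_bigl _ _ ltK) [x - _ + _]addrAC cosBpihalf.
  by rewrite [u K _ + _]addrC addrA [cos (_ + u K _)]cosD; ring.
rewrite meanB; [|exact: probability_setT|exact: bm1 bc|exact: bm1 bs].
rewrite Es Ec [in RHS](bigD1 K)//= (eq_bigl _ _ ltK).
rewrite [x - _ + _]addrAC cosBpihalf addrA [cos (x + psi + psiK)]cosD.
rewrite pE qE. ring.
Qed.

End Independence.

Section ComplexMeasurability.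
Context {R : realType}.

Lemma measurable_Re : measurable_fun setT (@complex.Re R).
Proof.
move=> _ B mB; rewrite setTI; exists (B `*` setT); first exact: measurableX.
by rewrite setTI; apply/seteqP; split => x //= -[].
Qed.

Lemma measurable_Im : measurable_fun setT (@complex.Im R).
Proof.
move=> _ B mB; rewrite setTI; exists (setT `*` B); first exact: measurableX.
by rewrite setTI; apply/seteqP; split => x //= -[].
Qed.

Lemma ReM (x y : R[i]) :
  complex.Re (x * y) = complex.Re x * complex.Re y - complex.Im x * complex.Im y.
Proof. by case: x => ? ?; case: y. Qed.

Lemma ImM (x y : R[i]) :
  complex.Im (x * y) = complex.Re x * complex.Im y + complex.Im x * complex.Re y.
Proof. by case: x => ? ?; case: y. Qed.

Lemma ReD (x y : R[i]) : complex.Re (x + y) = complex.Re x + complex.Re y.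
Proof. by case: x => ? ?; case: y. Qed.

Lemma ImD (x y : R[i]) : complex.Im (x + y) = complex.Im x + complex.Im y.
Proof. by case: x => ? ?; case: y. Qed.

Lemma ReN (x : R[i]) : complex.Re (- x) = - complex.Re x.
Proof. by case: x. Qed.

Lemma ImN (x : R[i]) : complex.Im (- x) = - complex.Im x.
Proof. by case: x. Qed.

Lemma Re_sum (I : Type) (r : seq I) (F : I -> R[i]) :
  complex.Re (\sum_(i <- r) F i) = \sum_(i <- r) complex.Re (F i).
Proof. by elim: r => [|i r IH]; rewrite ?big_nil// !big_cons ReD IH. Qed.

Lemma Im_sum (I : Type) (r : seq I) (F : I -> R[i]) :
  complex.Im (\sum_(i <- r) F i) = \sum_(i <- r) complex.Im (F i).
Proof. by elim: r => [|i r IH]; rewrite ?big_nil// !big_cons ImD IH. Qed.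

Lemma normcE (x : R[i]) :
  normc x = Num.sqrt (complex.Re x ^+ 2 + complex.Im x ^+ 2).
Proof. by case: x. Qed.

Lemma normc_sqr (x : R[i]) :
  normc x ^+ 2 = complex.Re x ^+ 2 + complex.Im x ^+ 2.
Proof. by rewrite normcE sqr_sqrtr// addr_ge0// sqr_ge0. Qed.

Lemma normc_ge0 (x : R[i]) : 0 <= normc x.
Proof. by rewrite normcE sqrtr_ge0. Qed.

Context {d : measure_display} {T : measurableType d}.

Lemma measurable_ReZ (c : R[i]) (f : T -> R[i]) :
  measurable_fun setT (fun w => complex.Re (f w)) ->
  measurable_fun setT (fun w => complex.Im (f w)) ->
  measurable_fun setT (fun w => complex.Re (c * f w)).
Proof.
move=> mr mi; under eq_fun do rewrite ReM.
by apply: measurable_funB; apply: measurable_funM => //; exact: measurable_cst.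
Qed.

Lemma measurable_ImZ (c : R[i]) (f : T -> R[i]) :
  measurable_fun setT (fun w => complex.Re (f w)) ->
  measurable_fun setT (fun w => complex.Im (f w)) ->
  measurable_fun setT (fun w => complex.Im (c * f w)).
Proof.
move=> mr mi; under eq_fun do rewrite ImM.
by apply: measurable_funD; apply: measurable_funM => //; exact: measurable_cst.
Qed.

Lemma measurable_normc (f : T -> R[i]) :
  measurable_fun setT (fun w => complex.Re (f w)) ->
  measurable_fun setT (fun w => complex.Im (f w)) ->
  measurable_fun setT (fun w => normc (f w)).
Proof.
move=> mr mi; under eq_fun do rewrite normcE.
apply: measurableT_comp.
  by apply: continuous_measurable_fun; exact: sqrt_continuous.
by apply: measurable_funD; exact: measurable_funX.
Qed.

Lemma measurable_normc_le (f : T -> R[i]) (r : R) :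
  measurable_fun setT (fun w => complex.Re (f w)) ->
  measurable_fun setT (fun w => complex.Im (f w)) ->
  measurable [set w | normc (f w) <= r].
Proof.
move=> mr mi.
have := measurable_normc _ mr mi measurableT _ (measurable_itv `]-oo, r]).
by rewrite setTI set_itvNyc.
Qed.

Lemma measurable_Re_lincomb {n : nat} (a : 'rV[R[i]]_n) (Z : 'I_n -> T -> R[i])
    (x : R[i]) : (forall i, measurable_fun setT (Z i)) ->
  measurable_fun setT (fun w => complex.Re (\sum_(i < n) a 0 i * Z i w - x)).
Proof.
move=> mZ; under eq_fun do rewrite ReD Re_sum.
apply: measurable_funD; last exact: measurable_cst.
apply: (@measurable_sum _ _ _ _ _ _ (fun i w => _)) => i.
by apply: measurable_ReZ; apply: measurableT_comp => //;
  [exact: measurable_Re|exact: measurable_Im].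
Qed.

Lemma measurable_Im_lincomb {n : nat} (a : 'rV[R[i]]_n) (Z : 'I_n -> T -> R[i])
    (x : R[i]) : (forall i, measurable_fun setT (Z i)) ->
  measurable_fun setT (fun w => complex.Im (\sum_(i < n) a 0 i * Z i w - x)).
Proof.
move=> mZ; under eq_fun do rewrite ImD Im_sum.
apply: measurable_funD; last exact: measurable_cst.
apply: (@measurable_sum _ _ _ _ _ _ (fun i w => _)) => i.
by apply: measurable_ImZ; apply: measurableT_comp => //;
  [exact: measurable_Re|exact: measurable_Im].
Qed.

End ComplexMeasurability.

Section Symmetrization.
Context {R : realType} {d : measure_display} {T : measurableType d}.
Variable P : probability T R.

Lemma product_setT : (P \x P)%E setT = 1%E.
Proof. have P1 : P setT = 1%E by exact: probability_setT.
by rewrite -setXTT product_measure1E// -[RHS]mule1; exact: (congr2 mule P1 P1). Qed.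

Lemma mean_product (f g : T -> R) : bounded_measurable f -> bounded_measurable g ->
  \int[(P \x P)%E]_w (f w.1 * g w.2) = (\int[P]_x f x) * (\int[P]_x g x).
Proof.
move=> bf bg.
have b12 : bounded_measurable (fun w : T * T => f w.1 * g w.2).
  by apply: bmM; apply: bm_comp.
rewrite /Rintegral -integral12_prod_meas1; last first.
  exact: (bm_integrable _ product_setT _ b12).
rewrite /fubini_F /=.
have Pg1 : P setT = 1%E by exact: probability_setT.
transitivity (fine (\int[P]_x (f x * \int[P]_y g y)%:E)).
  congr fine; apply: eq_integral => x _.
  rewrite -(meanZ P Pg1)// /Rintegral fineK//.
  by apply: integrable_fin_num => //; apply: bm_integrable => //; exact: bmZ.
by apply: (@RintegralZr _ _ _ P setT f _ measurableT); exact: bm_integrable.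
Qed.

(** The conjugate of the characteristic function of [X] is that of the opposite
    of an independent copy of [X]. *)
Lemma charmod_sqr (X : T -> R) : measurable_fun setT X ->
  charmod P X ^+ 2 = \int[(P \x P)%E]_w cos (X w.1 - X w.2).
Proof.
move=> mX; rewrite sqr_sqrtr ?addr_ge0 ?sqr_ge0// !expr2.
have bc := bm_cos _ mX; have bs := bm_sin _ mX.
under [RHS]eq_Rintegral do rewrite cosB.
have bcc : bounded_measurable (fun w : T * T => cos (X w.1) * cos (X w.2)).
  by apply: bmM; apply: (@bm_comp _ _ _ _ _ _ (fun x => cos (X x))).
have bss : bounded_measurable (fun w : T * T => sin (X w.1) * sin (X w.2)).
  by apply: bmM; apply: (@bm_comp _ _ _ _ _ _ (fun x => sin (X x))).
rewrite (meanD _ product_setT _ _ bcc bss).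
by rewrite (mean_product _ _ bc bc) (mean_product _ _ bs bs).
Qed.

(** With [c] the square of the left side, [c <= expR (- (1 - c))]. *)
Lemma charmod_le_expR (X : T -> R) : measurable_fun setT X ->
  charmod P X <= expR (- ((1 - \int[(P \x P)%E]_w cos (X w.1 - X w.2)) / 2)).
Proof.
move=> mX; rewrite -(@ler_pXn2r _ 2)// ?nnegrE ?sqrtr_ge0 ?expR_ge0//.
rewrite charmod_sqr// -expRM_natl; set c := Rintegral _ _ _.
rewrite (le_trans _ (expR_ge1Dx _))//; lra.
Qed.

End Symmetrization.

Lemma charmod_eq_law {R : realType} {d d'} {T : measurableType d}
    {T' : measurableType d'} {P : probability T R} {Q : probability T' R}
    {z : {RV P >-> R[i]}} {Z : {RV Q >-> R[i]}} {u : R[i] -> R} :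
  (forall A : set R[i], measurable A -> distribution Q Z A = distribution P z A) ->
  measurable_fun setT u ->
  charmod Q (u \o Z) = charmod P (u \o z).
Proof.
move=> law mu.
suff H (g : R[i] -> R) : bounded_measurable g ->
    \int[Q]_w g (Z w) = \int[P]_w g (z w).
  by rewrite /charmod /= (H (cos \o u)) 1?(H (sin \o u))//;
    [exact: bm_sin|exact: bm_cos].
move=> bg.
have mZ : measurable_fun setT Z by exact: measurable_funPT.
have mz : measurable_fun setT z by exact: measurable_funPT.
have mg : measurable_fun setT (EFin \o g) by apply/measurable_EFinP; exact: bg.1.
rewrite /Rintegral; congr fine.
rewrite -[LHS](@integral_distribution _ _ _ _ _ Q Z _ mg); last first.
  by apply: bm_integrable; [exact: probability_setT|exact: bm_comp].
rewrite -[RHS](@integral_distribution _ _ _ _ _ P z _ mg); last first.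
  by apply: bm_integrable; [exact: probability_setT|exact: bm_comp].
by apply: eq_measure_integral => A mA _; exact: law.
Qed.

Section Defect.
Context {R : realType} {n : nat}.
Implicit Types (a : 'rV[R[i]]_n) (x y : R[i]).

(** Comparable to the squared distance of the vector of the [Re (y * a_j)] to
    the integer lattice, but bounded and smooth, hence trivially measurable. *)
Definition defect a y : R :=
  \sum_j (1 - cos (2 * pi * complex.Re (y * a 0 j))).

Lemma defect_ge0 a y : 0 <= defect a y.
Proof. by apply: sumr_ge0 => j _; rewrite subr_ge0 cos_le1. Qed.

Lemma defectN a y : defect a (- y) = defect a y.
Proof. by apply: eq_bigr => j _; rewrite mulNr ReN mulrN cosN. Qed.

(** The squared triangle inequality for [1 - exp (i s)], whose square modulus is
    [2 * (1 - cos s)]. *)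
Lemma one_sub_cosD (s t : R) : 1 - cos (s + t) <= 2 * (1 - cos s) + 2 * (1 - cos t).
Proof.
have := cos2Dsin2 s; have := cos2Dsin2 t; rewrite cosD.
have := sqr_ge0 (1 - cos s - (1 - cos t)); have := sqr_ge0 (sin s - sin t).
have := cos_le1 s; have := cos_le1 t; nra.
Qed.

Lemma defectD a x y : defect a (x + y) <= 2 * defect a x + 2 * defect a y.
Proof.
rewrite /defect !mulr_sumr -big_split; apply: ler_sum => j _.
by rewrite [(x + y) * _]mulrDl ReD [2 * pi * (_ + _)]mulrDr one_sub_cosD.
Qed.

Context {d : measure_display} {T : measurableType d}.
Variables (P : probability T R) (z : {RV P >-> R[i]}).

Lemma measurable_sym (c : R[i]) :
  measurable_fun setT (fun w : T * T => complex.Re (c * (z w.1 - z w.2))).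
Proof.
have mz : measurable_fun setT z by exact: measurable_funPT.
have m1 (f : R[i] -> R) : measurable_fun setT f ->
    measurable_fun setT (fun w : T * T => f (z w.1)).
  by move=> mf; apply: (measurableT_comp mf (measurableT_comp mz _)).
have m2 (f : R[i] -> R) : measurable_fun setT f ->
    measurable_fun setT (fun w : T * T => f (z w.2)).
  by move=> mf; apply: (measurableT_comp mf (measurableT_comp mz _)).
apply: measurable_ReZ.
  under eq_fun do rewrite ReD ReN.
  by apply: measurable_funB; [apply: m1|apply: m2]; exact: measurable_Re.
under eq_fun do rewrite ImD ImN.
by apply: measurable_funB; [apply: m1|apply: m2]; exact: measurable_Im.
Qed.

Lemma bm_cos_sym (c : R[i]) :
  bounded_measurable (fun w : T * T => cos (2 * pi * complex.Re (c * (z w.1 - z w.2)))).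
Proof.
apply: bm_cos; apply: measurable_funM; first exact: measurable_cst.
exact: measurable_sym.
Qed.

Lemma bm_defect a (y : R[i]) :
  bounded_measurable (fun w : T * T => defect a (y * (z w.1 - z w.2))).
Proof.
apply: bm_sum => j; apply: bmB; first exact: bm_cst.
under [X in bounded_measurable X]eq_fun do rewrite [_ * (_ - _) * a 0 _]mulrAC.
exact: bm_cos_sym.
Qed.

(** The average of [defect] over the symmetrization of [z]. It inherits the
    quasi-subadditivity of [defect], so no conditioning on the size of
    [z w.1 - z w.2] is needed before the very last step. *)
Definition mean_defect a y : R :=
  (\int[(P \x P)%E]_w defect a (y * (z w.1 - z w.2))) / 2.

Let PP1 : (P \x P)%E setT = 1%E := product_setT P.

Lemma mean_defectN a y : mean_defect a (- y) = mean_defect a y.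
Proof.
congr (_ / _); apply: eq_Rintegral => w _.
by rewrite mulNr defectN.
Qed.

Lemma mean_defectD a x y :
  mean_defect a (x + y) <= 2 * mean_defect a x + 2 * mean_defect a y.
Proof.
rewrite /mean_defect !mulrA -mulrDl ler_pM2r// -!(meanZ _ PP1)//;
  try exact: bm_defect.
rewrite -(meanD _ PP1); try by apply: bmZ; exact: bm_defect.
apply: (le_mean _ PP1); first exact: bm_defect.
  by apply: bmD; apply: bmZ; exact: bm_defect.
by move=> w; rewrite mulrDl defectD.
Qed.

(** The characteristic function of the sum decays like [expR (- mean_defect)]:
    by independence it is a product over the coordinates, and each factor is
    bounded through its symmetrization. *)
Lemma mean_cos_le_expR {d' : measure_display} {T' : measurableType d'}
    {Q : probability T' R} {Z : 'I_n -> {RV Q >-> R[i]}} a (y x : R[i]) :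
  independent_copies z Z ->
  \int[Q]_w cos (2 * pi * complex.Re (y * (\sum_i a 0 i * Z i w - x))) <=
  expR (- mean_defect a y).
Proof.
move=> [law indZ].
pose u i s := 2 * pi * complex.Re (y * a 0 i * s).
have mu i : measurable_fun setT (u i).
  apply: measurable_funM; first exact: measurable_cst.
  by apply: measurable_ReZ; [exact: measurable_Re|exact: measurable_Im].
have uB i s t : u i s - u i t = 2 * pi * complex.Re (y * a 0 i * (s - t)).
  by rewrite /u -mulrBr -ReN -ReD -mulrBr.
rewrite (_ : \int[Q]_w _ =
    \int[Q]_w cos (- (2 * pi * complex.Re (y * x)) + \sum_i u i (Z i w))); last first.
  apply: eq_Rintegral => w _; congr cos.
  rewrite mulrBr ReD ReN mulr_sumr Re_sum mulrDr mulrN addrC; congr (_ + _).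
  by rewrite mulr_sumr; apply: eq_bigr => i _; rewrite /u mulrA.
apply: (le_trans (mean_cos_sum_le _ _ _ _ indZ mu)).
have mz : measurable_fun setT z by exact: measurable_funPT.
rewrite /mean_defect (mean_sum _ PP1); last first.
  move=> j; apply: bmB; first exact: bm_cst.
  under [X in bounded_measurable X]eq_fun do rewrite [_ * (_ - _) * a 0 _]mulrAC.
  exact: bm_cos_sym.
rewrite mulr_suml -sumrN expR_sum; apply: ler_prod => i _.
rewrite sqrtr_ge0 (charmod_eq_law (law i) (mu i)) /=.
rewrite (le_trans (charmod_le_expR P _ (measurableT_comp (mu i) mz)))//.
rewrite ler_expR lerN2 ler_pM2r// (meanB _ PP1) ?(mean_cst _ PP1); last 2 first.
- exact: bm_cst.
- under [X in bounded_measurable X]eq_fun do rewrite [_ * (_ - _) * a 0 _]mulrAC.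
  exact: bm_cos_sym.
rewrite lerD2l lerN2 le_eqVlt; apply/orP; left; apply/eqP.
by apply: eq_Rintegral => w _; rewrite /= uB [_ * (_ - _) * a 0 _]mulrAC.
Qed.

End Defect.

(** * A discrete Esseen inequality *)

Section Esseen.
Context {R : realType}.

Lemma cos_piquarter_sqr : cos (pi / 4) ^+ 2 = 1 / 2 :> R.
Proof.
have := cos_mulr2n (pi / 4 : R); rewrite (_ : pi / 4 *+ 2 = pi / 2).
  by rewrite cos_pihalf => /eqP; rewrite mulr2n; lra.
by rewrite mulr2n; lra.
Qed.

Lemma cos_ge_piquarter (t : R) : `|t| <= pi / 4 -> cos (pi / 4) <= cos t.
Proof.
move=> tp; have p0 := pi_gt0 R; rewrite -(cos_norm t).
have [->//|tn] := eqVneq `|t| (pi / 4).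
rewrite ltW// ltr_cos ?in_itv/= ?normr_ge0/=; last 2 first.
- lra.
- apply/andP; split; lra.
by rewrite lt_neqAle tn.
Qed.

Lemma cos_ge_half (t : R) : `|t| <= pi / 4 -> 1 / 2 <= cos t.
Proof.
move=> /cos_ge_piquarter; apply: le_trans; have p0 := pi_gt0 R.
have c40 : 0 <= cos (pi / 4) :> R by apply: cos_ge0_pihalf; lra.
have := cos_piquarter_sqr; nra.
Qed.

Definition gpoint (e : R) (j k : R) : R[i] := Complex (e * j) (e * k).

Definition grid_step (delta : R) (N : nat) : R := (16 * delta * N%:R)^-1.

Context {d : measure_display} {T : measurableType d}.
Variable Q : probability T R.

(** The square modulus of the average of [exp (i theta s)] over a grid of
    frequencies [theta] is nonnegative, and at least [1/4] when [|s| <= delta]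
    since then no phase exceeds [pi / 4]. *)
Lemma esseen_grid (S : T -> R[i]) (delta : R) (N : nat) :
  measurable_fun setT (fun w => complex.Re (S w)) ->
  measurable_fun setT (fun w => complex.Im (S w)) ->
  0 < delta -> (0 < N)%N ->
  (Q [set w | (normc (S w) <= delta)%R] <=
   (4 / N%:R ^+ 4 * \sum_(p : 'I_N * 'I_N) \sum_(q : 'I_N * 'I_N)
     \int[Q]_w cos (2 * pi * complex.Re
       (gpoint (grid_step delta N) (p.1%:R - q.1%:R) (p.2%:R - q.2%:R) * S w)))%:E)%E.
Proof.
move=> mR mI d0 N0; set e := grid_step delta N.
pose th (p : 'I_N * 'I_N) := gpoint e p.1%:R p.2%:R.
have thB (p q : 'I_N * 'I_N) : gpoint e (p.1%:R - q.1%:R) (p.2%:R - q.2%:R) = th p - th q.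
  by rewrite /th /gpoint !mulrBr.
under eq_bigr do under eq_bigr do under eq_Rintegral do rewrite thB.
have Q1 : Q setT = 1%E by exact: probability_setT.
have mA : measurable [set w | normc (S w) <= delta] by exact: measurable_normc_le.
pose u p w := 2 * pi * complex.Re (th p * S w).
have uB (p q : 'I_N * 'I_N) w : 2 * pi * complex.Re ((th p - th q) * S w) = u p w - u q w.
  by rewrite /u -mulrBr -ReN -ReD -mulrBl.
have bu p q : bounded_measurable (fun w => cos (2 * pi * complex.Re ((th p - th q) * S w))).
  apply: bm_cos; apply: measurable_funM; first exact: measurable_cst.
  exact: measurable_ReZ.
have NR : 0 < N%:R :> R by rewrite ltr0n.
rewrite -(mean_indic _ Q1)// lee_fin.
under eq_bigr do rewrite -(mean_sum _ Q1)//.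
rewrite -(mean_sum _ Q1); last by move=> p; exact: bm_sum.
rewrite -(meanZ _ Q1); last by apply: bm_sum => p; exact: bm_sum.
apply: (le_mean _ Q1); first exact: bm_indic.
  by apply: bmZ; apply: bm_sum => p; exact: bm_sum.
move=> w.
rewrite (_ : \sum_p _ = (\sum_p cos (u p w)) ^+ 2 + (\sum_p sin (u p w)) ^+ 2); last first.
  rewrite !expr2 !mulr_suml -big_split/=; apply: eq_bigr => p _.
  rewrite !mulr_sumr -big_split/=; apply: eq_bigr => q _.
  by rewrite uB cosB.
rewrite indicE; have [|_] := boolP (w \in _); last first.
  by rewrite mulr_ge0 ?divr_ge0 ?addr_ge0 ?sqr_ge0 ?exprn_ge0.
rewrite inE /= => Sd.
have cu p : 1 / 2 <= cos (u p w).
  apply: cos_ge_half; rewrite /u ReM /=.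
  have p0 := pi_gt0 R.
  have hR : `|complex.Re (S w)| <= delta.
    rewrite (le_trans _ Sd)// normcE -sqrtr_sqr ler_wsqrtr// lerDl sqr_ge0//.
  have hI : `|complex.Im (S w)| <= delta.
    rewrite (le_trans _ Sd)// normcE -sqrtr_sqr ler_wsqrtr// lerDr sqr_ge0//.
  have e0 : 0 < e by rewrite invr_gt0 !mulr_gt0.
  have H (k : 'I_N) (s : R) : `|s| <= delta -> `|e * k%:R * s| <= 1 / 16.
    move=> hs; rewrite !normrM (ger0_norm (ltW e0)) normr_nat.
    have -> : 1 / 16 = e * N%:R * delta :> R.
      by rewrite /e /grid_step; field; rewrite !gt_eqF.
    rewrite ler_pM// ?mulr_ge0 ?(ltW e0)// ler_pM2l// ler_nat ltnW//.
  have h1 := H p.1 _ hR; have h2 := H p.2 _ hI.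
  rewrite normrM ger0_norm ?mulr_ge0 ?(ltW p0)//.
  have := ler_normB (e * p.1%:R * complex.Re (S w)) (e * p.2%:R * complex.Im (S w)).
  nra.
have cs : N%:R ^+ 2 / 2 <= \sum_p cos (u p w).
  rewrite (_ : N%:R ^+ 2 / 2 = \sum_(p : 'I_N * 'I_N) (1 / 2)); first exact: ler_sum.
  by rewrite sumr_const card_prod card_ord -[RHS]mulr_natl natrM expr2 div1r.
rewrite (@le_trans _ _ (4 / N%:R ^+ 4 * (N%:R ^+ 2 / 2) ^+ 2))//.
  by rewrite le_eqVlt; apply/orP; left; apply/eqP; field; rewrite gt_eqF.
rewrite ler_pM2l ?divr_gt0 ?exprn_gt0// (@le_trans _ _ ((\sum_p cos (u p w)) ^+ 2))//.
  by rewrite ler_pXn2r// ?nnegrE ?(le_trans _ cs)// divr_ge0// exprn_ge0.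
by rewrite lerDl sqr_ge0.
Qed.

End Esseen.

(** * Sums over boxes of Gaussian integers *)

Section Counting.
Context {R : realType}.

Lemma sum_inj_le (I J : finType) (h : I -> J) (F : J -> R) :
  injective h -> (forall j, 0 <= F j) -> \sum_i F (h i) <= \sum_j F j.
Proof.
move=> hI F0; rewrite -(big_imset F (in2W hI)).
rewrite [leRHS](bigID (mem (h @: predT)%SET))/= lerDl.
exact: sumr_ge0.
Qed.

Lemma sum_fibre_le (A S : finType) (s : A -> S) (w : A -> R) (K : R) : 0 <= K ->
  (forall a0, (forall a, s a = s a0 -> w a <= w a0) ->
     \sum_(a | s a == s a0) w a <= K) ->
  \sum_a w a <= #|S|%:R * K.
Proof.
move=> K0 H; rewrite (partition_big s predT)//= mulr_natl -sumr_const.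
apply: ler_sum => y _.
have [a1 /eqP sa1|none] := pickP [pred a | s a == y]; last first.
  by rewrite big_pred0.
have /= [a0 /eqP sa0 max0] := @arg_maxP _ _ _ a1 [pred a | s a == y] w (introT eqP sa1).
rewrite -sa0; apply: H => a sa; apply: max0.
by rewrite /= sa sa0.
Qed.

(** For [Phi] quadratic up to constants, large values of [exp (- Phi)] at many
    points of a box force small values of [Phi x + Phi (i x)] at many
    differences [x]. Indeed, all pairs [(t, t')] with the same [t + i t']
    differ by [(- i x, x)]; comparing each pair with the heaviest pair in its
    class bounds its weight by a function of [x], and [x] determines the pair. *)
Lemma box_sum_sqr_le (Phi : R[i] -> R) (e : R) (N : nat) (K : R) :
  (forall x, Phi (- x) = Phi x) ->
  (forall x y, Phi (x + y) <= 2 * Phi x + 2 * Phi y) ->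
  (forall q : 'I_(2 * N).+1 * 'I_(2 * N).+1,
     \sum_(p : 'I_(2 * N).+1 * 'I_(2 * N).+1)
       expR (- ((Phi (gpoint e (p.1%:R - q.1%:R) (p.2%:R - q.2%:R)) +
                 Phi (gpoint e (- (p.2%:R - q.2%:R)) (p.1%:R - q.1%:R))) / 4))
     <= K) ->
  (\sum_(p : 'I_(2 * N).+1 * 'I_(2 * N).+1)
     expR (- Phi (gpoint e (p.1%:R - N%:R) (p.2%:R - N%:R)))) ^+ 2 <=
  (4 * N).+1%:R ^+ 2 * K.
Proof.
move=> PhiN PhiD HK.
pose I := ('I_(2 * N).+1 * 'I_(2 * N).+1)%type.
pose pt (p : I) := gpoint e (p.1%:R - N%:R) (p.2%:R - N%:R).
pose w (a : I * I) := expR (- (Phi (pt a.1) + Phi (pt a.2))).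
(* a code for [t + i t'], shifted so that both coordinates are natural *)
pose s (a : I * I) : 'I_(4 * N).+1 * 'I_(4 * N).+1 :=
  (inord (a.1.1 + (2 * N - a.2.2)), inord (a.1.2 + a.2.1)).
have K0 : 0 <= K by rewrite (le_trans _ (HK (ord0, ord0)))// sumr_ge0// => p _; exact: expR_ge0.
rewrite expr2 mulr_suml; under eq_bigr do rewrite mulr_sumr.
rewrite pair_bigA/= (eq_bigr w) => [|a _]; last by rewrite /w opprD expRD.
have -> : (4 * N).+1%:R ^+ 2 = #|{: 'I_(4 * N).+1 * 'I_(4 * N).+1}|%:R :> R.
  by rewrite card_prod card_ord natrM expr2.
apply: (@sum_fibre_le _ _ s) => // -[p0 q0] max0.
have sE a : s a = s (p0, q0) ->
    a.1.1%:R - p0.1%:R = a.2.2%:R - q0.2%:R :> R /\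
    a.1.2%:R - p0.2%:R = - (a.2.1%:R - q0.1%:R) :> R.
  move: a => [[p1 p2] [q1 q2]] /= [].
  have b (i : 'I_(2 * N).+1) : (i <= 2 * N)%N by rewrite -ltnS.
  have b4 (i j : nat) : (i <= 2 * N)%N -> (j <= 2 * N)%N -> (i + j < (4 * N).+1)%N.
    by move=> h1 h2; rewrite ltnS (leq_trans (leq_add h1 h2))// -mulnDl.
  move/(congr1 val); rewrite /= !inordK ?b4 ?leq_subr ?b// => E1.
  move/(congr1 val); rewrite /= !inordK ?b4 ?b// => E2.
  have := congr1 (fun m => m%:R : R) E1; rewrite /= !natrD !natrB ?b// => F1.
  have := congr1 (fun m => m%:R : R) E2; rewrite /= !natrD => F2.
  by split; lra.
pose kk (q : I) := expR (- ((Phi (gpoint e (q.1%:R - q0.1%:R) (q.2%:R - q0.2%:R)) +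
   Phi (gpoint e (- (q.2%:R - q0.2%:R)) (q.1%:R - q0.1%:R))) / 4)).
apply: (@le_trans _ _ (\sum_(a | s a == s (p0, q0)) kk a.2)).
  apply: ler_sum => a /eqP sa; rewrite ler_expR lerN2.
  have := max0 a sa; rewrite ler_expR lerN2 /= => wle.
  have [h1 h2] := sE a sa.
  have E1 : gpoint e (a.2.1%:R - q0.1%:R) (a.2.2%:R - q0.2%:R) = pt a.2 - pt q0.
    by rewrite /pt /gpoint; congr Complex; rewrite /=; ring.
  have E2 : gpoint e (- (a.2.2%:R - q0.2%:R)) (a.2.1%:R - q0.1%:R) = - (pt a.1 - pt p0).
    rewrite -h1 -[X in gpoint _ _ X]opprK -h2.
    by rewrite /pt /gpoint; congr Complex; rewrite /=; ring.
  rewrite E1 E2 PhiN.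
  have := PhiD (pt a.2) (- pt q0); have := PhiD (pt a.1) (- pt p0).
  by rewrite !PhiN; lra.
apply: le_trans (HK q0); rewrite -/I.
rewrite (eq_bigl (fun a : I * I => xpredT a.1 && (s (a.1, a.2) == s (p0, q0)))); last by case.
rewrite -(pair_big_dep xpredT (fun p q => s (p, q) == s (p0, q0)) (fun _ q => kk q))/=.
rewrite (exchange_big_dep xpredT)//=; apply: ler_sum => q _.
rewrite sumr_const -[leLHS]mulr_natr ler_piMr ?expR_ge0// lern1.
apply/card_le1_eqP => -[p1 p2] [p1' p2'] H1 H2.
have /eqP/sE[/= h1 h2] : s ((p1, p2), q) == s (p0, q0) := H1.
have /eqP/sE[/= h3 h4] : s ((p1', p2'), q) == s (p0, q0) := H2.
have e1 : p1 = p1' by apply/val_inj/eqP; rewrite -(eqr_nat R); apply/eqP; lra.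
have e2 : p2 = p2' by apply/val_inj/eqP; rewrite -(eqr_nat R); apply/eqP; lra.
by rewrite e1 e2.
Qed.

(** For each fixed [q], the differences [p - q] are distinct points of the box
    of side [2 * N + 1] centred at the origin. *)
Lemma box_diff_sum_le (F : R -> R -> R) (N : nat) : (forall x y, 0 <= F x y) ->
  \sum_(p : 'I_N * 'I_N) \sum_(q : 'I_N * 'I_N)
    F (p.1%:R - q.1%:R) (p.2%:R - q.2%:R) <=
  N%:R ^+ 2 * \sum_(p : 'I_(2 * N).+1 * 'I_(2 * N).+1)
    F (p.1%:R - N%:R) (p.2%:R - N%:R).
Proof.
move=> F0; set B := (X in _ * X).
have -> : N%:R ^+ 2 * B = \sum_(q : 'I_N * 'I_N) B.
  by rewrite sumr_const card_prod card_ord -[RHS]mulr_natl natrM expr2.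
rewrite exchange_big/=; apply: ler_sum => q _.
pose h (p : 'I_N * 'I_N) : 'I_(2 * N).+1 * 'I_(2 * N).+1 :=
  (inord (p.1 + (N - q.1)), inord (p.2 + (N - q.2))).
have bd (i j : 'I_N) : (i + (N - j) < (2 * N).+1)%N.
  by rewrite ltnS mul2n -addnn leq_add ?leq_subr// ltnW.
have hE (i j : 'I_N) : (inord (i + (N - j)) : 'I_(2 * N).+1)%:R - N%:R = i%:R - j%:R :> R.
  by rewrite inordK ?bd// natrD natrB ?(ltnW (ltn_ord j))//; ring.
under eq_bigr => p _ do rewrite -(hE p.1 q.1) -(hE p.2 q.2).
apply: (@sum_inj_le _ _ h (fun r => F (r.1%:R - N%:R) (r.2%:R - N%:R))) => //.
move=> [p1 p2] [p1' p2'] [] /(congr1 val) + /(congr1 val).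
rewrite /= !inordK ?bd// => /addIn/val_inj -> /addIn/val_inj ->; done.
Qed.

Lemma geom_right_le (x : R) (M j0 : nat) : 0 <= x < 1 ->
  \sum_(j < M) (if (j0 <= j)%N then x ^+ (j - j0) else 0) <= (1 - x)^-1.
Proof.
move=> /andP[x0 x1]; rewrite -[leRHS]mul1r ler_pdivlMr ?subr_gt0//.
suff -> : (\sum_(j < M) (if (j0 <= j)%N then x ^+ (j - j0) else 0)) * (1 - x) =
    1 - x ^+ (M - j0) by rewrite gerBl exprn_ge0.
elim: M => [|M IH]; first by rewrite big_ord0 mul0r sub0n expr0 subrr.
rewrite big_ord_recr/= mulrDl IH; case: leqP => h; last first.
  have -> : (M - j0 = 0)%N by apply/eqP; rewrite subn_eq0 ltnW.
  have -> : (M.+1 - j0 = 0)%N by apply/eqP; rewrite subn_eq0.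
  by rewrite mul0r addr0.
by rewrite subSn// exprS; ring.
Qed.

Lemma geom_left_le (x : R) (M j0 : nat) : 0 <= x < 1 ->
  \sum_(j < M) (if (j <= j0)%N then x ^+ (j0 - j) else 0) <= (1 - x)^-1.
Proof.
move=> /andP[x0 x1]; rewrite -[leRHS]mul1r ler_pdivlMr ?subr_gt0//.
suff : (\sum_(j < M) (if (j <= j0)%N then x ^+ (j0 - j) else 0)) * (1 - x) <=
    x ^+ (j0.+1 - M) by move/le_trans; apply; rewrite exprn_ile1// ltW.
elim: M => [|M IH]; first by rewrite big_ord0 mul0r exprn_ge0.
rewrite big_ord_recr/= mulrDl; case: leqP => h.
  rewrite subSS; move: IH; rewrite subSn// exprS => IH; nra.
have -> : (j0.+1 - M.+1 = 0)%N by apply/eqP; rewrite subn_eq0 ltnW.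
by move: IH; have -> : (j0.+1 - M = 0)%N by [apply/eqP; rewrite subn_eq0]; rewrite mul0r addr0.
Qed.

(** Comparison with a two-sided geometric series, via [t - 1/4 <= t ^+ 2]. *)
Lemma gauss_sum_le (k : R) (M j0 : nat) : 0 < k <= 1 ->
  \sum_(j < M) expR (- (k * (j%:R - j0%:R)) ^+ 2) <= 8 / k.
Proof.
move=> /andP[k0 k1]; pose x := expR (- k).
have x0 : 0 <= x := expR_ge0 _.
have x1 : x < 1 by rewrite /x expR_lt1 oppr_lt0.
have xk : k / 2 <= 1 - x.
  have : x * (1 + k) <= 1.
    by rewrite -[leRHS](expRxMexpNx_1 k) mulrC ler_pM2r ?expR_gt0// expR_ge1Dx.
  nra.
have e2 (t : R) : expR (- t ^+ 2) <= 2 * expR (- t).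
  have h : expR (t - t ^+ 2) <= 2.
    rewrite (@le_trans _ _ (expR (1 / 4)))//.
      by rewrite ler_expR; have := sqr_ge0 (t - 1 / 2); nra.
    have := expR_ge1Dx (- (1 / 4) : R); have := expRxMexpNx_1 (1 / 4 : R).
    have := expR_gt0 (1 / 4 : R); nra.
  rewrite (_ : - t ^+ 2 = (t - t ^+ 2) + - t); last by ring.
  by rewrite expRD ler_pM2r// expR_gt0.
rewrite (@le_trans _ _ (\sum_(j < M) 2 *
  ((if (j0 <= j)%N then x ^+ (j - j0) else 0) +
   (if (j <= j0)%N then x ^+ (j0 - j) else 0))))//.
  apply: ler_sum => j _.
  have xE m : x ^+ m = expR (- (k * m%:R)).
    by rewrite /x -expRM_natr mulNr.
  case: (leqP j0 j) => [h|/ltnW h].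
    rewrite (le_trans (e2 _))// ler_pM2l// -natrB// -xE lerDl.
    by case: ifP => // _; rewrite exprn_ge0.
  rewrite h (_ : (k * (j%:R - j0%:R)) ^+ 2 = (k * (j0%:R - j%:R)) ^+ 2); last by ring.
  by rewrite (le_trans (e2 _))// ler_pM2l// -natrB// -xE lerDr.
rewrite -mulr_sumr big_split/=.
have xb : 0 <= x < 1 by rewrite x0.
have := geom_right_le x M j0 xb; have := geom_left_le x M j0 xb.
have : (1 - x)^-1 <= 2 / k.
  by rewrite -invf_div lef_pV2// ?posrE ?divr_gt0//; lra.
by rewrite (_ : 8 / k = 4 * (2 / k)); [lra|field; rewrite gt_eqF].
Qed.

Lemma box_gauss_sum_le (k E : R) (N : nat) (q : 'I_(2 * N).+1 * 'I_(2 * N).+1) :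
  0 < k <= 1 ->
  \sum_(p : 'I_(2 * N).+1 * 'I_(2 * N).+1)
     (expR (- (k ^+ 2 * ((p.1%:R - q.1%:R) ^+ 2 + (p.2%:R - q.2%:R) ^+ 2))) + E) <=
  (8 / k) ^+ 2 + (2 * N).+1%:R ^+ 2 * E.
Proof.
move=> hk; have /andP[k0 k1] := hk.
rewrite big_split/= sumr_const card_prod card_ord.
rewrite -[E *+ _]mulr_natl natrM -expr2 lerD2r.
under eq_bigr do rewrite mulrDr opprD expRD.
rewrite -(pair_bigA _ (fun i j : 'I_(2 * N).+1 =>
  expR (- (k ^+ 2 * (i%:R - q.1%:R) ^+ 2)) * expR (- (k ^+ 2 * (j%:R - q.2%:R) ^+ 2))))/=.
under eq_bigr do rewrite -mulr_sumr.
rewrite -mulr_suml [(8 / k) ^+ 2]expr2; under eq_bigr do rewrite -exprMn.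
under [X in _ * X <= _]eq_bigr do rewrite -exprMn.
rewrite ler_pM ?gauss_sum_le//; apply: sumr_ge0 => ? _; exact: expR_ge0.
Qed.

End Counting.

(** * From the defect to the least common denominator *)

Section LCDBound.
Context {R : realType}.

(** The mean value theorem at [t / 2], where the cosine is at least
    [cos (pi / 4)], and the double angle formula; [cos (pi / 4) ^+ 2 = 1 / 2]
    gives the constant. *)
Lemma sin_ge_half (t : R) : 0 <= t <= pi / 2 -> t / 2 <= sin t.
Proof.
move=> /andP[t0 tp]; pose c : R := cos (pi / 4).
have c2 : c ^+ 2 = 1 / 2 := cos_piquarter_sqr.
have c0 : 0 <= c by rewrite (le_trans _ (cos_ge_half (pi / 4) _))// ger0_norm// divr_ge0// pi_ge0.
have h : 0 <= t / 2 by lra.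
have [x] := @MVT_segment R sin cos 0 (t / 2) h (fun x _ => is_derive_sin x)
  (continuous_subspaceT (@continuous_sin R)).
rewrite in_itv/= sin0 !subr0 => /andP[x0 xt] E.
have ct : c <= cos (t / 2) by apply: cos_ge_piquarter; rewrite ger0_norm//; lra.
have cx : c <= cos x by apply: cos_ge_piquarter; rewrite ger0_norm//; lra.
have -> : sin t = 2 * sin (t / 2) * cos (t / 2).
  by rewrite -[in LHS](_ : (t / 2) *+ 2 = t) ?sin_mulr2n mulr2n; [ring|lra].
have h1 : c * (t / 2) <= sin (t / 2) by rewrite E ler_wpM2r.
have h2 : c * (t / 2) * c <= sin (t / 2) * cos (t / 2).
  by apply: ler_pM => //; rewrite mulr_ge0.
have : c * (t / 2) * c = t / 4 by rewrite mulrAC -expr2 c2; field.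
lra.
Qed.

Lemma cosD_2pi_int (t : R) (m : int) : cos (2 * pi * (t - m%:~R)) = cos (2 * pi * t).
Proof.
have P (k : nat) (u : R) : cos (2 * pi * (u + k%:R)) = cos (2 * pi * u).
  rewrite -[RHS](periodicn (@cosD2pi R) k) mulrDr; congr (cos (_ + _)).
  by rewrite -mulr_natr mulr2n; ring.
case: m => k; first by rewrite -[in RHS](subrK k%:R t) P.
by rewrite NegzE mulrNz opprK P.
Qed.

(** With [s] the distance from [t] to the nearest integer, the left side is
    [2 * s ^+ 2] and the right side is [2 * sin (pi * s) ^+ 2]. *)
Lemma one_sub_cos_ge (t : R) : exists m : int,
  2 * (t - m%:~R) ^+ 2 <= 1 - cos (2 * pi * t).
Proof.
pose m := Num.floor (t + 1 / 2); exists m.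
have /andP[] := floor_itv (t + 1 / 2); rewrite -/m intrD => m1 m2.
rewrite -(cosD_2pi_int _ m); set s := t - m%:~R.
have s2 : `|s| <= 1 / 2 by rewrite ler_norml; apply/andP; split; rewrite /s; lra.
rewrite -(cos_norm (2 * pi * s)) normrM ger0_norm ?mulr_ge0 ?pi_ge0//.
rewrite -[s ^+ 2]real_normK ?num_real//; set r := `|s| in s2 *.
have r0 : 0 <= r by exact: normr_ge0.
have p2 := pi_ge2 R.
have -> : 2 * pi * r = (pi * r) *+ 2 by rewrite mulr2n; ring.
have h : pi * r / 2 <= sin (pi * r) by apply: sin_ge_half; apply/andP; split; nra.
have h' : r <= sin (pi * r) by nra.
rewrite cos_mulr2n cos2sin2 mulr2n.
have : r ^+ 2 <= sin (pi * r) ^+ 2 by rewrite ler_pXn2r// nnegrE// (le_trans r0).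
lra.
Qed.

Context {n : nat}.
Implicit Types (a v : 'rV[R[i]]_n).

Lemma l2norm_ge0 v : 0 <= l2norm v.
Proof. exact: sqrtr_ge0. Qed.

Lemma dist_gaussian_le v g : gaussian_lattice g ->
  dist_gaussian v <= l2norm (v - g).
Proof.
move=> gL; apply: ge_inf; last by exists g.
by exists 0 => _ [h _ <-]; exact: l2norm_ge0.
Qed.

(** The defects at [y] and [i y] see the real and the imaginary parts of
    [y *: a], hence together the distance to the Gaussian integers. *)
Lemma defect_ge_dist a (y : R[i]) : exists2 g, gaussian_lattice g &
  2 * l2norm (y *: a - g) ^+ 2 <= defect a y + defect a (Complex 0 1 * y).
Proof.
have [p hp] := choice (fun j => one_sub_cos_ge (complex.Re (y * a 0 j))).
have [q hq] := choice (fun j => one_sub_cos_ge (complex.Im (y * a 0 j))).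
exists (\row_j Complex (p j)%:~R (q j)%:~R).
  by move=> j; rewrite mxE /=; split; exact: intr_int.
rewrite sqr_sqrtr; last by apply: sumr_ge0 => j _; exact: sqr_ge0.
rewrite mulr_sumr -big_split/=; apply: ler_sum => j _.
rewrite normc_sqr !mxE ReD ImD ReN ImN /= mulrDr lerD//.
by rewrite -[Complex 0 1 * y * _]mulrA (ReM (Complex 0 1)) /= mul0r mul1r sub0r mulrN cosN.
Qed.

Lemma defect_ge_min (gamma alpha : R) a (y : R[i]) :
  0 < gamma -> 0 < alpha -> l2norm a = 1 -> 0 < normc y ->
  ((normc y)%:E < LCD gamma alpha a)%E ->
  2 * Num.min (gamma * normc y) alpha ^+ 2 <=
  defect a y + defect a (Complex 0 1 * y).
Proof.
move=> g0 al0 a1 y0 yL; have [g gL] := defect_ge_dist a y.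
apply: le_trans; rewrite ler_pM2l// ler_pXn2r ?nnegrE ?l2norm_ge0//; last first.
  by rewrite le_min mulr_ge0 ?ltW.
rewrite leNgt; apply/negP => lt; move: yL; rewrite ltNge => /negP; apply.
apply: ereal_inf_lbound; exists y => //=; split => //.
by rewrite a1 mulr1 (le_lt_trans (dist_gaussian_le _ _ gL)).
Qed.

(** The quotient by the least common denominator takes the value [+oo] at zero
    and [0] at infinity, so the hypothesis on it excludes the former case. *)
Lemma LCD_gt (gamma alpha x r delta : R) a :
  0 < delta -> 0 < x -> (x%:E / LCD gamma alpha a <= delta%:E)%E ->
  delta * r < x -> (r%:E < LCD gamma alpha a)%E.
Proof.
move=> d0 x0 xd dr.
have : (0 <= LCD gamma alpha a)%E.
  by apply: le_ereal_inf_tmp => _ [y [y0 _] <-]; rewrite lee_fin ltW.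
case: (LCD gamma alpha a) xd => [l| |]//; last by rewrite ltry.
rewrite inver; case: eqP => [->|/eqP l0 +] .
  by rewrite gt0_muley ?lte_fin// leye_eq.
rewrite -EFinM !lee_fin lte_fin => xl lge; have lp : 0 < l by rewrite lt_def l0.
have : x <= delta * l by rewrite -ler_pdivrMr.
by move=> h; rewrite -(ltr_pM2l d0) (lt_le_trans dr).
Qed.

Context {d : measure_display} {T : measurableType d}.
Variables (P : probability T R) (z : {RV P >-> R[i]}).

Lemma mean_defect_ge0 a y : 0 <= mean_defect P z a y.
Proof.
by rewrite divr_ge0//; apply: Rintegral_ge0 => w _; exact: defect_ge0.
Qed.

(** On the event where the difference of two copies of [z] has modulus between
    [Cz^-1] and [Cz], multiplying [x] by it keeps the modulus below the least
    common denominator, and [defect_ge_min] applies to the product. *)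
Lemma mean_defect_ge_min (Cz gamma alpha : R) a (x : R[i]) :
  1 <= Cz -> C_good Cz z -> 0 < gamma -> 0 < alpha -> l2norm a = 1 ->
  0 < normc x -> ((Cz * normc x)%:E < LCD gamma alpha a)%E ->
  Cz^-1 * Num.min (gamma * normc x / Cz) alpha ^+ 2 <=
  mean_defect P z a x + mean_defect P z a (Complex 0 1 * x).
Proof.
move=> C1 good g0 al0 a1 x0 xL; have C0 : 0 < Cz by rewrite (lt_le_trans ltr01).
have PP1 : (P \x P)%E setT = 1%E := product_setT P.
pose A : set (T * T) := [set w | (Cz^-1 <= normc (z w.1 - z w.2) <= Cz)].
have mA : measurable A.
  have mn : measurable_fun setT (fun w : T * T => normc (z w.1 - z w.2)).
    have mRe := measurable_sym P z 1; have mIm := measurable_sym P z (- Complex 0 1).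
    apply: measurable_normc.
      by under eq_fun do rewrite -[z _ - z _]mul1r.
    have -> // : (fun w : T * T => complex.Im (z w.1 - z w.2)) =
        (fun w => complex.Re (- Complex 0 1 * (z w.1 - z w.2))).
    by apply/funext => w; rewrite (ReM (- Complex 0 1)) /= oppr0 mul0r sub0r mulNr mul1r opprK.
  have := mn measurableT _ (measurable_itv `[Cz^-1, Cz]).
  by rewrite setTI; congr measurable; apply/seteqP; split => w /=; rewrite in_itv.
set m := Num.min _ _.
have m0 : 0 <= m by rewrite le_min ltW ?divr_gt0 ?mulr_gt0//= ltW.
have CA : Cz^-1 <= \int[(P \x P)%E]_w (\1_A w).
  by rewrite -lee_fin (mean_indic _ PP1).
rewrite /mean_defect -mulrDl ler_pdivlMr// -(meanD _ PP1); try exact: bm_defect.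
have b1 : bounded_measurable (\1_A : T * T -> R) by exact: bm_indic.
apply: (@le_trans _ _ (\int[(P \x P)%E]_w (2 * m ^+ 2 * \1_A w))).
  rewrite (meanZ _ PP1)// (_ : _ * 2 = 2 * m ^+ 2 * Cz^-1); last by ring.
  by rewrite ler_wpM2l// mulr_ge0 ?sqr_ge0.
apply: (le_mean _ PP1); first exact: bmZ.
  by apply: bmD; exact: bm_defect.
move=> w; rewrite indicE; have [|_] := boolP (w \in A); last first.
  by rewrite mulr0 addr_ge0 ?defect_ge0.
rewrite inE /A /= => /andP[]; set s := z w.1 - z w.2 => s1 s2.
have s0 : 0 < normc s by rewrite (lt_le_trans _ s1)// invr_gt0.
have y0 : 0 < normc (x * s) by rewrite normcM mulr_gt0.
have yL : ((normc (x * s))%:E < LCD gamma alpha a)%E.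
  by rewrite (le_lt_trans _ xL)// lee_fin normcM mulrC ler_pM2r.
have := defect_ge_min _ _ _ _ g0 al0 a1 y0 yL; rewrite mulr1 -[Complex 0 1 * x * s]mulrA.
apply: le_trans; rewrite ler_pM2l// ler_pXn2r ?nnegrE//; last first.
  by rewrite le_min ltW ?mulr_gt0//= ltW.
rewrite /m le_min !ge_min lexx orbT andbT; apply/orP; left.
by rewrite normcM -mulrA ler_pM2l// ler_pM2l.
Qed.

End LCDBound.

(** * The small ball estimate *)

Section SmallBall.
Context {R : realType} {d : measure_display} {T : measurableType d}.
Variables (P : probability T R) (z : {RV P >-> R[i]}).

Lemma mul_i_gpoint (e j k : R) : Complex 0 1 * gpoint e j k = gpoint e (- k) j.
Proof. by apply/eqP; rewrite eq_complex ReM ImM /=; apply/andP; split; apply/eqP; ring. Qed.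

(** The two terms correspond to the two values of the minimum in
    [mean_defect_ge_min]. A grid point of a box of side [2 * N] has modulus at
    most [4 * N * e = (4 * delta)^-1], whence the condition on the least common
    denominator. *)
Lemma gpoint_weight_le {n : nat} (Cz gamma alpha delta e j k : R) (N : nat)
    (a : 'rV[R[i]]_n) :
  1 <= Cz -> C_good Cz z -> 0 < gamma -> 0 < alpha -> l2norm a = 1 ->
  0 < delta -> (0 < N)%N -> e = grid_step delta N ->
  ((Cz / (4 * delta))%:E < LCD gamma alpha a)%E ->
  `|j| <= 2 * N%:R -> `|k| <= 2 * N%:R ->
  expR (- ((mean_defect P z a (gpoint e j k) +
            mean_defect P z a (gpoint e (- k) j)) / 4)) <=
  expR (- ((gamma * e / (2 * Cz ^+ 2)) ^+ 2 * (j ^+ 2 + k ^+ 2))) +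
  expR (- (alpha ^+ 2 / (4 * Cz))).
Proof.
move=> C1 good g0 al0 a1 d0 N0 eE CL jN kN.
have C0 : 0 < Cz by rewrite (lt_le_trans ltr01).
have NR : 0 < N%:R :> R by rewrite ltr0n.
have e0 : 0 < e by rewrite eE invr_gt0 !mulr_gt0.
have x2 : normc (gpoint e j k) ^+ 2 = e ^+ 2 * (j ^+ 2 + k ^+ 2).
  by rewrite normc_sqr /=; ring.
rewrite -mul_i_gpoint; set x := gpoint e j k in x2 *.
have [x0|x0] := eqVneq (normc x) 0.
  rewrite x0 expr0n/= in x2.
  have -> : j ^+ 2 + k ^+ 2 = 0.
    apply/eqP; move/esym/eqP: x2; rewrite mulf_eq0 => /orP[|//].
    by rewrite expf_eq0/= gt_eqF.
  rewrite mulr0 oppr0 expR0 (@le_trans _ _ 1)//; last by rewrite lerDl expR_ge0.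
  by rewrite -[leRHS]expR0 ler_expR oppr_le0 divr_ge0// addr_ge0 ?mean_defect_ge0.
have xp : 0 < normc x by rewrite lt_def x0 normc_ge0.
have xL : ((Cz * normc x)%:E < LCD gamma alpha a)%E.
  apply: le_lt_trans CL; rewrite lee_fin ler_pM2l//.
  rewrite -(@ler_pXn2r _ 2)// ?nnegrE ?normc_ge0 ?invr_ge0 ?mulr_ge0 ?(ltW d0)//.
  have -> : (4 * delta)^-1 = e * (4 * N%:R).
    by rewrite eE /grid_step; field; rewrite !gt_eqF.
  rewrite x2 exprMn ler_pM2l ?exprn_gt0//.
  have hj : j ^+ 2 <= (2 * N%:R) ^+ 2 by rewrite -[j ^+ 2]real_normK ?num_real// ler_pXn2r ?nnegrE.
  have hk : k ^+ 2 <= (2 * N%:R) ^+ 2 by rewrite -[k ^+ 2]real_normK ?num_real// ler_pXn2r ?nnegrE.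
  rewrite !exprMn in hj hk *; have := sqr_ge0 (N%:R : R); lra.
have := mean_defect_ge_min P z Cz gamma alpha a x C1 good g0 al0 a1 xp xL.
set M := _ + mean_defect _ _ _ _ => hM.
have [h|h] := leP (gamma * normc x / Cz) alpha.
  apply: (@le_trans _ _ (expR (- ((gamma * e / (2 * Cz ^+ 2)) ^+ 2 * (j ^+ 2 + k ^+ 2))))).
    rewrite ler_expR lerN2 ler_pdivlMr//; apply: le_trans hM; rewrite min_l//.
    have -> : (gamma * e / (2 * Cz ^+ 2)) ^+ 2 * (j ^+ 2 + k ^+ 2) * 4 =
        gamma ^+ 2 * normc x ^+ 2 * (Cz ^+ 4)^-1.
      by rewrite x2; field; rewrite gt_eqF.
    have -> : Cz^-1 * (gamma * normc x / Cz) ^+ 2 =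
        gamma ^+ 2 * normc x ^+ 2 * (Cz ^+ 3)^-1.
      by field; rewrite gt_eqF.
    apply: ler_wpM2l; first by rewrite mulr_ge0 ?sqr_ge0.
    by rewrite lef_pV2 ?posrE ?exprn_gt0// ler_weXn2l.
  by rewrite lerDl expR_ge0.
apply: (@le_trans _ _ (expR (- (alpha ^+ 2 / (4 * Cz))))); last by rewrite lerDr expR_ge0.
rewrite ler_expR lerN2 ler_pdivlMr//; apply: le_trans hM; rewrite min_r ?(ltW h)//.
by rewrite le_eqVlt; apply/orP; left; apply/eqP; field; rewrite gt_eqF.
Qed.

(** The discrete Esseen inequality reduces the probability to [4 / N ^ 2] times
    a sum of [expR (- mean_defect)] over a box of the grid; its square is
    bounded by the doubling argument, the Gaussian sum and [gpoint_weight_le].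
    Taking the square root at the end turns the two-dimensional volume bound
    [(delta / gamma) ^ 2] into [delta / gamma]. *)
Lemma small_ball_le {n : nat} (C Cz gamma alpha delta : R) (a : 'rV[R[i]]_n) (x : R[i])
    {d' : measure_display} {T' : measurableType d'} (Q : probability T' R)
    (Z : 'I_n -> {RV Q >-> R[i]}) :
  1 <= Cz -> 5120 * Cz ^+ 2 <= C -> C_good Cz z -> independent_copies z Z ->
  0 < gamma < 1 -> 0 < alpha -> l2norm a = 1 -> 0 < delta ->
  ((Cz / (4 * delta))%:E < LCD gamma alpha a)%E ->
  (Q [set w | (normc (\sum_(i < n) a 0 i * Z i w - x) <= delta)%R] <=
   (C * (delta / gamma + expR (- (alpha ^+ 2 / (8 * Cz)))))%:E)%E.
Proof.
move=> C1 C5120 good indZ /andP[g0 g1] al0 a1 d0 CL.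
have C0 : 0 < Cz by rewrite (lt_le_trans ltr01).
(* makes the step [e] of the grid at most 1 *)
pose N := (Num.truncn delta^-1).+1.
have N0 : (0 < N)%N by [].
have NR : 0 < N%:R :> R by rewrite ltr0n.
have N1 : 1 <= N%:R :> R by rewrite ler1n.
have dN : 1 <= delta * N%:R.
  by rewrite mulrC -ler_pdivrMr// mul1r; exact/ltW/truncnS_gt.
pose e := grid_step delta N.
have e0 : 0 < e by rewrite invr_gt0 !mulr_gt0.
have e1 : e <= 1 by rewrite /e /grid_step invf_le1 -?mulrA ?mulr_gt0//; lra.
pose Phi := mean_defect P z a.
have mZ i : measurable_fun setT (Z i) by exact: measurable_funPT.
have mR := measurable_Re_lincomb a _ x mZ.
have mI := measurable_Im_lincomb a _ x mZ.
apply: (le_trans (esseen_grid Q _ _ _ mR mI d0 N0)); rewrite lee_fin -/e.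
pose J := \sum_(p : 'I_(2 * N).+1 * 'I_(2 * N).+1)
  expR (- Phi (gpoint e (p.1%:R - N%:R) (p.2%:R - N%:R))).
have J0 : 0 <= J by apply: sumr_ge0 => p _; exact: expR_ge0.
apply: (@le_trans _ _ (4 / N%:R ^+ 4 * (N%:R ^+ 2 * J))).
  rewrite ler_pM2l ?divr_gt0 ?exprn_gt0//.
  have := box_diff_sum_le (fun u v => expR (- Phi (gpoint e u v))) N
    (fun u v => expR_ge0 _); apply: le_trans.
  by apply: ler_sum => p _; apply: ler_sum => q _; exact: mean_cos_le_expR.
pose k := gamma * e / (2 * Cz ^+ 2).
pose E := expR (- (alpha ^+ 2 / (8 * Cz))).
have E0 : 0 <= E := expR_ge0 _.
have EE : expR (- (alpha ^+ 2 / (4 * Cz))) = E ^+ 2.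
  by rewrite -expRM_natl; congr expR; field; rewrite gt_eqF.
have k0 : 0 < k by rewrite divr_gt0 ?mulr_gt0 ?exprn_gt0.
have k1 : k <= 1.
  rewrite ler_pdivrMr ?mulr_gt0 ?exprn_gt0// mul1r.
  have : gamma * e <= 1 by rewrite mulr_ile1// ltW.
  have : 1 <= Cz ^+ 2 by rewrite exprn_ege1.
  lra.
have hk : 0 < k <= 1 by rewrite k0.
have JJ : J ^+ 2 <= (4 * N).+1%:R ^+ 2 * ((8 / k) ^+ 2 + (2 * N).+1%:R ^+ 2 * E ^+ 2).
  apply: (box_sum_sqr_le Phi e N); first exact: mean_defectN.
    exact: mean_defectD.
  move=> q; apply: le_trans (box_gauss_sum_le k (E ^+ 2) N q hk).
  have b (i j : 'I_(2 * N).+1) : `|i%:R - j%:R| <= 2 * N%:R :> R.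
    have hi : (i%:R : R) <= 2 * N%:R by rewrite -natrM ler_nat -ltnS.
    have hj : (j%:R : R) <= 2 * N%:R by rewrite -natrM ler_nat -ltnS.
    have : 0 <= (i%:R : R) := ler0n _ _; have : 0 <= (j%:R : R) := ler0n _ _.
    by rewrite ler_norml => ? ?; apply/andP; split; lra.
  apply: ler_sum => p _; rewrite -EE.
  exact: (gpoint_weight_le _ _ _ delta _ _ _ N).
have N4 : (4 * N).+1%:R <= 5 * N%:R :> R by rewrite -natr1 natrM; lra.
have N2 : (2 * N).+1%:R <= 3 * N%:R :> R by rewrite -natr1 natrM; lra.
have J1 : J <= 5 * N%:R * (8 / k + 3 * N%:R * E).
  have k8 : 0 <= 8 / k by rewrite divr_ge0// ltW.
  have NE : 0 <= 3 * N%:R * E by rewrite !mulr_ge0// ltW.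
  rewrite -(@ler_pXn2r _ 2)// ?nnegrE//; last first.
    by rewrite mulr_ge0 ?addr_ge0// mulr_ge0// ltW.
  apply: (le_trans JJ); rewrite [(_ * (8 / k + _)) ^+ 2]exprMn; apply: ler_pM.
  - exact: sqr_ge0.
  - by apply: addr_ge0; [exact: sqr_ge0|apply: mulr_ge0; exact: sqr_ge0].
  - by rewrite ler_pXn2r ?nnegrE// mulr_ge0// ltW.
  have B0 : 0 <= (2 * N).+1%:R * E by rewrite mulr_ge0.
  have : (2 * N).+1%:R * E <= 3 * N%:R * E by rewrite ler_wpM2r.
  rewrite -[X in _ + X <= _]exprMn; move: k8 NE B0.
  move: (8 / k) (3 * N%:R * E) (_%:R * E) => x1 x2 x3; nra.
apply: (@le_trans _ _ (4 / N%:R ^+ 4 * (N%:R ^+ 2 * (5 * N%:R * (8 / k + 3 * N%:R * E))))).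
  by rewrite ler_pM2l ?divr_gt0 ?exprn_gt0// ler_pM2l ?exprn_gt0.
have -> : 4 / N%:R ^+ 4 * (N%:R ^+ 2 * (5 * N%:R * (8 / k + 3 * N%:R * E))) =
    5120 * Cz ^+ 2 * (delta / gamma) + 60 * E.
  by rewrite /k /e /grid_step; field; rewrite !gt_eqF.
have X0 : 0 <= delta / gamma by rewrite divr_ge0 ?ltW.
have h1 := ler_wpM2r X0 C5120.
have C60 : 60 <= C.
  by apply: le_trans C5120; have : 1 <= Cz ^+ 2 by [rewrite exprn_ege1]; lra.
have h2 := ler_wpM2r E0 C60.
by rewrite mulrDr lerD.
Qed.

End SmallBall.

Theorem theorem2p11 (R : realType) (Cz : R) (hCz : 1 <= Cz) :
  exists C : R, 1 <= C /\
  forall (d : measure_display) (T : measurableType d) (P : probability T R)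
    (z : {RV P >-> R[i]}),
  C_good Cz z ->
  forall n : nat, (0 < n)%N ->
  forall (d' : measure_display) (T' : measurableType d')
    (Q : probability T' R) (Z : 'I_n -> {RV Q >-> R[i]}),
  independent_copies z Z ->
  forall (a : 'rV[R[i]]_n), l2norm a = 1 ->
  forall alpha : R, 0 < alpha < Num.sqrt n%:R ->
  forall gamma : R, 0 < gamma < 1 ->
  forall delta : R, 0 < delta ->
  ((n%:R `^ (1 / 10) * alpha)%:E / LCD gamma alpha a <= delta%:E)%E ->
  (concentration Z delta a <=
   (C * (Num.sqrt n%:R * delta / gamma + expR (- (C^-1 * alpha ^+ 2))))%:E)%E.
Proof.
have C0 : 0 < Cz by rewrite (lt_le_trans ltr01).
have Cz2 : Cz <= Cz ^+ 2 by rewrite ler_eXnr.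
have [C [C1 C5120 C8 Cs]] : exists C : R,
    [/\ 1 <= C, 5120 * Cz ^+ 2 <= C, 8 * Cz <= C & 1 + Cz ^+ 2 <= C].
  by exists (5120 * Cz ^+ 2); split; lra.
have Cp : 0 < C by rewrite (lt_le_trans ltr01).
exists C; split => // d T P z good n n0 d' T' Q Z indZ a a1 alpha /andP[al0 aln].
move=> gamma hg delta d0 hd; have /andP[g0 g1] := hg.
have sn1 : 1 <= Num.sqrt n%:R :> R by rewrite -[leLHS]sqrtr1 ler_wsqrtr// ler1n.
have dg0 : 0 <= delta / gamma by rewrite divr_ge0 ?ltW.
have dgn : delta / gamma <= Num.sqrt n%:R * delta / gamma.
  by rewrite -mulrA ler_peMl.
apply: ge_ereal_sup => _ [x _ <-].
have [aC|Ca] := ltP alpha Cz.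
  (* for small [alpha] the exponential term alone exceeds 1 *)
  apply: (@le_trans _ _ 1%E).
    apply: probability_le1; have mZ i : measurable_fun setT (Z i).
      exact: measurable_funPT.
    by apply: measurable_normc_le;
      [exact: measurable_Re_lincomb|exact: measurable_Im_lincomb].
  rewrite lee_fin.
  have h : 1 - C^-1 * alpha ^+ 2 <= expR (- (C^-1 * alpha ^+ 2)).
    exact: expR_ge1Dx.
  have h2 : C * (1 - C^-1 * alpha ^+ 2) = C - alpha ^+ 2.
    by rewrite mulrBr mulr1 mulVKf// gt_eqF.
  have h3 : alpha ^+ 2 <= Cz ^+ 2.
    by rewrite ler_pXn2r // ?nnegrE ?(ltW aC) ?(ltW al0) ?(ltW C0).
  have h4 : 0 <= C * (Num.sqrt n%:R * delta / gamma).
    by apply: mulr_ge0; [exact: ltW|exact: le_trans dgn].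
  have := ler_wpM2l (ltW Cp) h; rewrite h2 => h5.
  rewrite mulrDr (le_trans _ (lerD h4 h5))// add0r lerBrDr.
  by rewrite (le_trans _ Cs)// lerD2l.
have CL : ((Cz / (4 * delta))%:E < LCD gamma alpha a)%E.
  apply: (LCD_gt _ _ _ _ _ _ d0 _ hd).
    by rewrite mulr_gt0// powR_gt0// ltr0n.
  have n1 : 1 <= n%:R `^ (1 / 10) :> R.
    by rewrite -[leLHS](powRr0 n%:R) ler_powR ?ler1n.
  have -> : delta * (Cz / (4 * delta)) = Cz / 4 by field; rewrite gt_eqF.
  rewrite (@lt_le_trans _ _ alpha)//; first lra.
  by rewrite ler_peMl// ltW.
apply: (le_trans (small_ball_le _ _ _ _ _ _ _ _ x _ _
                    hCz C5120 good indZ hg al0 a1 d0 CL)).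
rewrite lee_fin; apply: ler_wpM2l; first exact: ltW.
apply: lerD; first exact: dgn.
rewrite ler_expR lerN2 [leLHS]mulrC; apply: ler_wpM2l; first exact: sqr_ge0.
by rewrite lef_pV2 ?posrE// mulr_gt0.
Qed.
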